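(* There exist three positive universal constants $c_1$, $c_2$ and $c_3$ such that the following holds. Assume that the integers $k_0,\Delta,n$ satisfy $n/c_1\ge\Delta\ge c_1k_0\ge c_1\sqrt n$ and $n\ge c_2$. Then $$\rho^{*2}_{\gamma,\mathrm{var}}[k_0,\Delta]\ \ge\ c_3\,\sigma_+^2\,\frac{\sqrt{\Delta k_0}}{\log(1+k_0/\sqrt n)} .$$
   Context: Model: $Y_i=\theta_i+\epsilon_i$, $i=1,\dots,n$, with $\theta\in\mathbb R^n$ unknown and $\epsilon_i$ i.i.d. $\mathcal N(0,\sigma^2)$, where $\sigma$ is unknown but belongs to a fixed interval $[\sigma_-,\sigma_+]$ with $0<\sigma_-<\sigma_+$ known; $\mathbb P_{\theta,\sigma}$ is the law of $Y$. $\mathbb B_0[k]=\{\theta\in\mathbb R^n:\|\theta\|_0\le k\}$, where $\|\theta\|_0$ is the number of non-zero entries; $d_2$ is the Euclidean distance; $\mathbb B_0[k_1,k_0,\rho]=\{\theta\in\mathbb B_0[k_1]:d_2(\theta,\mathbb B_0[k_0])\ge\rho\}$. For a test $T$ (measurable $\{0,1\}$-valued function of $Y$, not depending on $\sigma$), $$R_{\mathrm{var}}(T;k_0,\Delta,\rho)=\sup_{\theta\in\mathbb B_0[k_0],\,\sigma\in[\sigma_-,\sigma_+]}\mathbb P_{\theta,\sigma}[T=1]+\sup_{\theta\in\mathbb B_0[k_0+\Delta,k_0,\rho],\,\sigma\in[\sigma_-,\sigma_+]}\mathbb P_{\theta,\sigma}[T=0].$$ For a fixed $\gamma\in(0,1)$,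 $\rho_{\gamma,\mathrm{var}}(T;k_0,\Delta)=\sup\{\rho>0:R_{\mathrm{var}}(T;k_0,\Delta,\rho)>\gamma\}$ and $\rho^*_{\gamma,\mathrm{var}}[k_0,\Delta]=\inf_T\rho_{\gamma,\mathrm{var}}(T;k_0,\Delta)$, infimum over all tests; $\rho^{*2}_{\gamma,\mathrm{var}}$ denotes its square.
   Formalization: The constants c1, c2, c3 may depend on γ and on an upper bound κ<1 for σ_-/σ_+ (not on n, k0, Δ or the scale of σ); with constants independent of γ and of σ_-/σ_+ the claim fails as γ→1 and σ_-/σ_+→1. *)

(* Defs.v *)
From HB Require Import structures.
From mathcomp Require Import all_boot all_order all_algebra.
From mathcomp Require Import all_classical all_reals all_analysis.
From mathcomp Require Import measurable_realfun.
Set Implicit Arguments.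
Unset Strict Implicit.
Unset Printing Implicit Defensive.
Import Order.TTheory GRing.Theory Num.Theory.
Import numFieldNormedType.Exports.
Local Open Scope classical_set_scope.
Local Open Scope ring_scope.

(* Supremum in [0, +oo], so that the supremum of the empty set is 0
   (ereal_sup set0 is -oo, whose square would be +oo). *)
Definition nnsup (R : realType) (A : set (\bar R)) : \bar R :=
  ereal_sup (0%E |` A).

Section iid.
Context d (T : measurableType d) (R : realType).

Definition consp n (x : T * n.-tuple T) : n.+1.-tuple T :=
  [tuple of x.1 :: x.2].

Lemma measurable_consp n : measurable_fun [set: T * n.-tuple T] (@consp n).
Proof.
by apply: (@measurable_cons _ _ (T * n.-tuple T)%type T fst n snd);
  [exact: measurable_fst|exact: measurable_snd].
Qed.

HB.instance Definition _ n :=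
  isMeasurableFun.Build _ _ _ _ (@consp n) (@measurable_consp n).

(* The n-fold product of P, i.e. the law of n i.i.d. variables of law P. *)
Fixpoint iid_prob (P : probability T R) (n : nat) :
    probability (n.-tuple T) R :=
  match n with
  | 0 => \d_ [tuple]
  | m.+1 => distribution (P \x iid_prob P m)%E (@consp m)
  end.

End iid.

Lemma iid_prob_box d (T : measurableType d) (R : realType)
    (P : probability T R) n (A : 'I_n -> set T) :
  (forall i, measurable (A i)) ->
  iid_prob P n [set x | forall i, A i (tnth x i)] = (\prod_(i < n) P (A i))%E.
Proof.
elim: n A => [|n IHn] A mA.
  by rewrite big_ord0 /= diracE mem_set// => -[].
rewrite big_ord_recl -IHn; last by move=> i; exact: mA.
rewrite /= /distribution /pushforward.
rewrite (_ : _ @^-1` _ = A ord0 `*`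
    [set x | forall i, A (lift ord0 i) (tnth x i)]); last first.
  apply/seteqP; split=> [[x y] /= Axy|[x y] /= [Ax Ay] i].
    by split=> [|i]; [exact: (Axy ord0)|have := Axy (lift ord0 i); rewrite tnthS].
  by have [j ->|->//] := unliftP ord0 i; rewrite tnthS.
rewrite product_measure1E//.
rewrite (_ : [set x | _] = \bigcap_(i in [set: 'I_n])
    ((fun x : n.-tuple T => tnth x i) @^-1` A (lift ord0 i))); last first.
  by apply/seteqP; split=> x /= + i => /(_ i); [|exact].
apply: fin_bigcap_measurable => // i _.
by rewrite -[X in measurable X]setTI; exact: measurable_tnth.
Qed.

Section gauss.
Context (R : realType) (sigma : R).

(* N(0, sigma^2); normal_prob takes the mean and the standard deviation.
   normal_prob is declared on measurableTypeR R, an alias of R with the same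
   measurable sets; it is transported here to R itself. *)
Definition gauss (A : set R) : \bar R := normal_prob 0 sigma A.

Let P0 : probability (measurableTypeR R) R := normal_prob 0 sigma.

Let gauss0 : gauss set0 = 0%E. Proof. exact: (measure0 P0). Qed.

Let gauss_ge0 A : (0 <= gauss A)%E. Proof. exact: (measure_ge0 P0). Qed.

Let gauss_sigma_additive : semi_sigma_additive gauss.
Proof. exact: (@measure_semi_sigma_additive _ _ _ P0). Qed.

HB.instance Definition _ :=
  isMeasure.Build _ _ _ gauss gauss0 gauss_ge0 gauss_sigma_additive.

Let gaussT : gauss setT = 1%E. Proof. exact: (@probability_setT _ _ _ P0). Qed.

HB.instance Definition _ := Measure_isProbability.Build _ _ _ gauss gaussT.

End gauss.

Section model.
Context (R : realType) (n : nat).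
Implicit Types (theta : n.-tuple R) (sigma : R).

Definition observe theta (eps : n.-tuple R) : n.-tuple R :=
  [tuple tnth theta i + tnth eps i | i < n].

Lemma measurable_observe theta : measurable_fun [set: n.-tuple R] (observe theta).
Proof.
apply/measurable_fun_tnthP => i.
rewrite (_ : _ \o _ = fun eps : n.-tuple R => tnth theta i + tnth eps i).
  by apply: measurable_funD => //; exact: measurable_tnth.
by apply/funext => eps /=; rewrite tnth_mktuple.
Qed.

HB.instance Definition _ theta :=
  isMeasurableFun.Build _ _ _ _ (observe theta) (measurable_observe theta).

Definition lawY theta sigma : probability (n.-tuple R) R :=
  distribution (iid_prob (gauss sigma) n) (observe theta).

Definition l0norm theta : nat := #|[set i | tnth theta i != 0]%SET|.

Definition d2 theta theta' : R :=
  Num.sqrt (\sum_(i < n) (tnth theta i - tnth theta' i) ^+ 2).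

Definition d2set theta (A : set (n.-tuple R)) : R := inf [set d2 theta u | u in A].

Definition B0 (k : nat) : set (n.-tuple R) := [set theta | (l0norm theta <= k)%N].

Definition B0sep (k1 k0 : nat) (rho : R) : set (n.-tuple R) :=
  [set theta | B0 k1 theta /\ rho <= d2set theta (B0 k0)].

Definition test := {mfun n.-tuple R >-> bool}.

Section risk.
Context (sigma_m sigma_p : R).

Definition Rvar (T : test) (k0 Delta : nat) (rho : R) : \bar R :=
  (nnsup [set lawY p.1 p.2 [set y | T y = true] |
           p in B0 k0 `*` `[sigma_m, sigma_p]] +
   nnsup [set lawY p.1 p.2 [set y | T y = false] |
           p in B0sep (k0 + Delta) k0 rho `*` `[sigma_m, sigma_p]])%E.

Definition rho_var (gamma : R) (T : test) (k0 Delta : nat) : \bar R :=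
  nnsup [set rho%:E | rho in
    [set rho | 0 < rho /\ (gamma%:E < Rvar T k0 Delta rho)%E]].

Definition rho_star_var (gamma : R) (k0 Delta : nat) : \bar R :=
  ereal_inf [set rho_var gamma T k0 Delta | T in [set: test]].

End risk.
End model.

(* Main.v *)
(* The two hypotheses are mixed with product priors whose one-coordinate
   observation laws have the same moments up to a high order.  Under the null,
   the noise level is sigma_+ and a coordinate of theta is 0 except for a few
   spikes on a lattice of step h.  Under the alternative, the noise level is
   slightly smaller, and the missing variance is compensated by about Delta
   coordinates with theta_i^2 of order sigma_+^2 (k0/Delta)^(1/2) / m and by a
   Gaussian blur of all nonzero atoms.  The spikes, about k0 of them, have weights given by Lagrange
   interpolation at 0, 1, 4, ..., m^2, so that moments match up to order 2m+1.
   Expanding the exponentials in the chi-square divergence of one coordinate,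
   all matched terms cancel and the Taylor remainders give O((k0/n)^2 e^(-2m));
   with m of order log(k0/sqrt n) this is small after tensorization over n
   coordinates.  A Chernoff bound shows that the priors charge the null and the
   separated alternative up to a small probability. *)
Require Import Defs.
From HB Require Import structures.
From mathcomp Require Import all_boot all_order all_algebra.
From mathcomp Require Import all_classical all_reals all_analysis.
From mathcomp Require Import measurable_realfun ring lra zify.
Set Implicit Arguments.
Unset Strict Implicit.
Unset Printing Implicit Defensive.
Import Order.TTheory GRing.Theory Num.Theory.
Import numFieldNormedType.Exports.
Local Open Scope classical_set_scope.
Local Open Scope ring_scope.

(** * Integration against product and Gaussian laws *)

(** Relative to the density of N(0, s^2), the law N(s a, s^2) has Hermite coefficients a^k, and N(0,
    s^2 (1 - tau)) has those of a Gaussian of variance -tau. A blur of variance s^2 tau brings every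
    nonzero atom of the alternative back to total variance s^2. Apart from one component, both
    mixtures then consist of translates of a single Gaussian, and matching becomes a finite linear
    problem on lattice weights. With [tau = P * w * h2], the atoms at +-sqrt([w * h2]) of weight P
    balance the second moment by themselves. The spikes only correct order four onwards, so their
    mass is of order [P * w ^+ 2] instead of [P * w]. Asking n P w^2 of order k0, with P of order
    Delta/n, gives w of order sqrt(k0/Delta). Interpolation produces signed weights: positive parts
    go to the null, negative parts to the alternative. The spacing [h2 = 1 / (81 m)] keeps the
    largest squared atom at m/81 (in units of s^2), small enough for the factorials to leave a
    margin e^(-2m). *)

Lemma emeasurable_prod d (T : measurableType d) (R : realType) n
    (f : 'I_n -> T -> \bar R) : (forall i, measurable_fun setT (f i)) ->
  measurable_fun setT (fun x => (\prod_(i < n) f i x)%E).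
Proof.
elim: n f => [|n IHn] f mf.
  rewrite (_ : (fun _ => _) = cst 1%E)//.
  by apply/funext => x; rewrite big_ord0.
under eq_fun do rewrite big_ord_recl.
by apply: emeasurable_funM => //; exact: IHn.
Qed.

Section consp.
Context d (T : measurableType d) n (x : T) (y : n.-tuple T).

Lemma tnth_consp0 : tnth (consp (x, y)) ord0 = x. Proof. by []. Qed.

Lemma tnth_conspS i : tnth (consp (x, y)) (lift ord0 i) = tnth y i.
Proof. exact: tnthS. Qed.

End consp.

Section iid_integral.
Local Open Scope ereal_scope.
Context d (T : measurableType d) (R : realType).
Implicit Types (P : probability T R).

Lemma integral_iid_prob0 P (f : 0.-tuple T -> \bar R) :
  measurable_fun setT f -> \int[iid_prob P 0]_x f x = f [tuple].
Proof. by move=> mf; rewrite /= integral_dirac// diracT mul1e. Qed.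

Lemma integral_iid_probS P n (f : n.+1.-tuple T -> \bar R) :
  measurable_fun setT f -> (forall x, 0 <= f x) ->
  \int[iid_prob P n.+1]_x f x
  = \int[P]_x \int[iid_prob P n]_y f (consp (x, y)).
Proof.
move=> mf f0.
rewrite ge0_integral_distribution// fubini_tonelli1//=.
exact: measurableT_comp.
Qed.

Lemma integral_iid_prob_prod P (g : T -> \bar R) n :
  measurable_fun setT g -> (forall x, 0 <= g x) ->
  \int[iid_prob P n]_x (\prod_(i < n) g (tnth x i)) = (\int[P]_x g x) ^+ n.
Proof.
move=> mg g0; elim: n => [|n IHn].
  under eq_integral do rewrite big_ord0.
  by rewrite integral_cst// expe0 [X in 1 * X](probability_setT (iid_prob P 0)) mule1.
have mpg k : measurable_fun [set: k.-tuple T]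
    (fun x : k.-tuple T => \prod_(i < k) g (tnth x i)).
  apply: emeasurable_prod => i.
  by apply: measurableT_comp => //; exact: measurable_tnth.
have pg0 k (x : k.-tuple T) : 0 <= \prod_(i < k) g (tnth x i).
  exact: prode_ge0.
rewrite integral_iid_probS// expeS -IHn -ge0_integralZr//=; last by apply: integral_ge0 => x _; exact: pg0.
apply: eq_integral => x _.
rewrite -ge0_integralZl//; [|exact: mpg|by move=> y _; exact: pg0].
apply: eq_integral => y _; rewrite big_ord_recl tnth_consp0; congr *%E.
by apply: eq_bigr => i _; rewrite tnth_conspS.
Qed.
End iid_integral.

Section density.
Local Open Scope ereal_scope.
Context d (T : measurableType d) (R : realType).
Context (mu nu : {measure set T -> \bar R}) (f : T -> R).
Hypothesis mf : measurable_fun setT f.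
Hypothesis f0 : forall x, (0 <= f x)%R.
Hypothesis nuE : forall A, measurable A -> nu A = \int[mu]_(x in A) (f x)%:E.

Import HBNNSimple.

Let nnsfunE (h : {nnsfun T >-> R}) :
  \int[nu]_x (h x)%:E = \int[mu]_x ((h x)%:E * (f x)%:E).
Proof.
under [LHS]eq_integral do rewrite fimfunE -fsumEFin//.
rewrite [LHS]ge0_integral_fsum//; last 2 first.
  - by move=> r; exact/measurable_EFinP/measurableT_comp.
  - by move=> n x _; rewrite EFinM nnfun_muleindic_ge0.
under [RHS]eq_integral.
  move=> x xD; rewrite fimfunE -fsumEFin// muleC ge0_mule_fsumr; last first.
    by move=> r; rewrite EFinM nnfun_muleindic_ge0.
  over.
rewrite [RHS]ge0_integral_fsum//; last 2 first.
  - move=> r; apply: emeasurable_funM; first exact/measurable_EFinP.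
    by apply/measurable_EFinP; do 2 apply/measurableT_comp => //.
  - by move=> n x _; rewrite EFinM mule_ge0 ?nnfun_muleindic_ge0 ?lee_fin.
apply: eq_fsbigr => r _; rewrite integralZl_indic_nnsfun//.
under [RHS]eq_integral do rewrite EFinM muleCA.
have [r0|r0] := ltP r 0%R.
  rewrite preimage_nnfun0// integral_indic// set0I measure0 mule0.
  by rewrite integral0_eq// => x _; rewrite indic0 !mule0.
rewrite ge0_integralZl//; last 2 first.
  - by apply: emeasurable_funM; exact/measurable_EFinP.
  - by move=> x _; rewrite mule_ge0 ?lee_fin.
congr (_ * _); rewrite integral_indic//= setIT nuE// integral_mkcond.
apply: eq_integral => x _; rewrite patchE indicE.
by case: ifP; rewrite ?mule1 ?mule0.
Qed.

(** [nuE] only concerns sets: [nnsfunE] extends it to simple functions by linearity, and monotone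
    convergence along [nnsfun_approx] to all nonnegative integrands. *)
Lemma ge0_integral_density (g : T -> \bar R) :
  measurable_fun setT g -> (forall x, 0 <= g x) ->
  \int[nu]_x g x = \int[mu]_x (g x * (f x)%:E).
Proof.
move=> mg g0; pose g_ := nnsfun_approx measurableT mg.
transitivity (limn (fun n => \int[nu]_x (g_ n x)%:E)).
  rewrite -monotone_convergence//=.
  - apply: eq_integral => x /[!inE] xD; apply/esym/cvg_lim => //=.
    exact: cvg_nnsfun_approx.
  - by move=> n; apply: measurableT_comp => //; exact: measurable_funTS.
  - by move=> n x _; rewrite lee_fin.
  - by move=> x _ a b ab; rewrite lee_fin//; exact/lefP/nd_nnsfun_approx.
under eq_fun do rewrite nnsfunE.
rewrite -monotone_convergence//=.
- apply: eq_integral => x _; apply/cvg_lim => //=.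
  apply: cvgeZr => //; exact: cvg_nnsfun_approx.
- by move=> n; apply: emeasurable_funM; exact/measurable_EFinP.
- by move=> n x _; rewrite mule_ge0// lee_fin.
- move=> x _ a b ab; rewrite lee_wpmul2r ?lee_fin//.
  exact/lefP/nd_nnsfun_approx.
Qed.
End density.

Section gauss_integral.
Local Open Scope ereal_scope.
Context (R : realType).
Local Notation mu := (@lebesgue_measure R).

(** The pushforward of Lebesgue measure under the shift has the right values on half-open intervals,
    which determine the measure. *)
Lemma integral_lebesgue_translation (c : R) (g : R -> \bar R) :
  measurable_fun setT g -> (forall x, 0 <= g x) ->
  \int[mu]_x g (c + x)%R = \int[mu]_x g x.
Proof.
move=> mg g0.
pose tr (x : measurableTypeR R) : measurableTypeR R := (c + x)%R.
have mc : measurable_fun setT tr by exact: measurable_funD.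
have := @ge0_integral_pushforward _ _ (measurableTypeR R) (measurableTypeR R) R _ mc mu setT g measurableT mg.
rewrite preimage_setT => <-; last by move=> *.
apply/esym/eq_measure_integral => A mA _.
apply: (lebesgue_measure_unique (mu := pushforward mu tr)) => //.
move=> X [[a b] _ <-] /=.
rewrite /pushforward.
rewrite (_ : _ @^-1` _ = `](a - c)%R, (b - c)%R]%classic); last first.
  by apply/seteqP; split=> x /=; rewrite !in_itv/= ltrBlDl lerBrDl.
by rewrite !lebesgue_measure_itv/= !lte_fin ltrD2r -!EFinB opprB addrA subrK.
Qed.

Lemma integral_normal_prob (m s : R) (g : R -> \bar R) :
  measurable_fun setT g -> (forall x, 0 <= g x) ->
  \int[normal_prob m s]_x g x = \int[mu]_x (g x * (normal_pdf m s x)%:E).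
Proof.
move=> mg g0.
apply: (@ge0_integral_density _ (measurableTypeR R) R mu (normal_prob m s)
  (normal_pdf m s)) => //.
- exact: measurable_normal_pdf.
- exact: normal_pdf_ge0.
Qed.

Lemma integral_gauss (s : R) (g : R -> \bar R) :
  measurable_fun setT g -> (forall x, 0 <= g x) ->
  \int[gauss s]_x g x = \int[mu]_x (g x * (normal_pdf 0 s x)%:E).
Proof.
move=> mg g0; rewrite -integral_normal_prob//.
(* [gauss] lives on [R] and [normal_prob] on its alias; the identity map between the two carriers
   pushes one law onto the other. *)
have mid : measurable_fun [set: measurableTypeR R] (idfun : measurableTypeR R -> R).
  by move=> _ A mA; rewrite setTI.
have := @ge0_integral_pushforward _ _ _ _ R _ mid (normal_prob 0 s) setT g
  measurableT mg.
rewrite preimage_setT => <-; last by move=> *.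
by apply: eq_measure_integral => A mA _.
Qed.

Lemma integral_gauss_translation (c s : R) (g : R -> \bar R) : s != 0%R ->
  measurable_fun setT g -> (forall x, 0 <= g x) ->
  \int[gauss s]_x g (c + x)%R = \int[mu]_x (g x * (normal_pdf c s x)%:E).
Proof.
move=> s0 mg g0; rewrite integral_gauss; last 2 first.
- by apply: measurableT_comp => //; exact: measurable_funD.
- by move=> x; exact: g0.
have mp : measurable_fun [set: R] (fun x => g x * (normal_pdf c s x)%:E).
  apply: emeasurable_funM => //; apply/measurable_EFinP.
  exact: measurable_normal_pdf.
rewrite -(integral_lebesgue_translation c mp); last first.
  by move=> x; rewrite mule_ge0// lee_fin normal_pdf_ge0.
apply: eq_integral => x _; congr (_ * _%:E).
by rewrite !normal_pdfE// /normal_fun subr0 addrAC subrr add0r.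
Qed.
End gauss_integral.

Section probability_of_measure.
Context d (T : measurableType d) (R : realType).
Context (nu : {measure set T -> \bar R}) (nu1 : nu setT = 1%E).

(** The dummy [let] makes [nu1] a parameter of the definition, so that the probability instance
    below can retrieve the total mass from the term. *)
Definition probability_of : set T -> \bar R := let _ := nu1 in nu.

HB.instance Definition _ := Measure.copy probability_of nu.
HB.instance Definition _ :=
  Measure_isProbability.Build _ _ _ probability_of nu1.
End probability_of_measure.

Section mixture.
Local Open Scope ereal_scope.
Context d (T : measurableType d) (R : realType).

Lemma integral_prob1 (P : probability T R) : \int[P]_x 1 = 1.
Proof. by rewrite integral_cst// [X in 1 * X](probability_setT P) mule1. Qed.

(** The mixture is built by recursion on the enumeration of [I] from scaled and added measures; only
    its integrals are ever used. *)
Lemma mixture_exists (I : finType) (c : I -> R) (m : I -> probability T R) :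
  (forall i, 0 <= c i)%R -> (\sum_i c i = 1)%R ->
  exists Q : probability T R, forall g : T -> \bar R,
    measurable_fun setT g -> (forall x, 0 <= g x) ->
    \int[Q]_x g x = \sum_i (c i)%:E * \int[m i]_x g x.
Proof.
move=> c0 c1.
have [nu nuE] : exists nu : {measure set T -> \bar R}, forall g : T -> \bar R,
    measurable_fun setT g -> (forall x, 0 <= g x) ->
    \int[nu]_x g x = \sum_(i <- index_enum I) (c i)%:E * \int[m i]_x g x.
  elim: (index_enum I) => [|i s [nu IH]].
    exists mzero => g mg g0; rewrite big_nil; exact: integral_measure_zero.
  exists (measure_add (mscale (NngNum (c0 i)) (m i)) nu) => g mg g0.
  by rewrite ge0_integral_measure_add// ge0_integral_mscale// big_cons IH.
have nuT : nu setT = 1.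
  rewrite -[LHS]mul1e -integral_cst// (nuE (cst 1))//.
  under eq_bigr do rewrite integral_prob1 mule1.
  by rewrite sumEFin c1.
by exists (probability_of nuT) => g mg g0; rewrite -nuE.
Qed.
End mixture.

Section gauss_convolution.
Local Open Scope ereal_scope.
Context (R : realType).
Local Notation mu := (@lebesgue_measure R).

(** Completing the square in x: the joint density of a Gaussian mean x and an observation y is the
    marginal of y times the posterior of x. *)
Lemma normal_pdf_mul_conv (s t x y : R) : (0 < s)%R -> (0 < t)%R ->
  (normal_pdf x s y * normal_pdf 0 t x =
   normal_pdf 0 (Num.sqrt (s ^+ 2 + t ^+ 2)) y *
   normal_pdf (t ^+ 2 * y / (s ^+ 2 + t ^+ 2))
     (s * t / Num.sqrt (s ^+ 2 + t ^+ 2)) x)%R.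
Proof.
move=> s0 t0.
have s20 : (0 < s ^+ 2)%R by rewrite exprn_gt0.
have t20 : (0 < t ^+ 2)%R by rewrite exprn_gt0.
have r2 : (0 < s ^+ 2 + t ^+ 2)%R by rewrite addr_gt0.
set r := Num.sqrt _.
have r0 : (0 < r)%R by rewrite sqrtr_gt0.
have rE : (r ^+ 2 = s ^+ 2 + t ^+ 2)%R by rewrite sqr_sqrtr// ltW.
rewrite !normal_pdfE ?gt_eqF ?divr_gt0 ?mulr_gt0//.
rewrite /normal_peak /normal_fun.
rewrite mulrACA [RHS]mulrACA -!expRD -!invfM -!sqrtrM; last 2 first.
- by rewrite mulrn_wge0// mulr_ge0 ?pi_ge0// sqr_ge0.
- by rewrite mulrn_wge0// mulr_ge0 ?pi_ge0// sqr_ge0.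
rewrite expr_div_n rE.
congr ((Num.sqrt _)^-1 * expR _)%R.
  by field; rewrite gt_eqF.
by field; rewrite !gt_eqF.
Qed.

Lemma measurable_shift (c : R) : measurable_fun [set: R] (fun x : R => c + x)%R.
Proof. exact: measurable_funD. Qed.

(** After exchanging the integrals by Tonelli, the posterior density of [normal_pdf_mul_conv]
    integrates to 1 and the marginal remains. *)
Lemma integral_gauss_gauss (s t c : R) (g : R -> \bar R) :
  (0 < s)%R -> (0 < t)%R ->
  measurable_fun setT g -> (forall x, 0 <= g x) ->
  \int[gauss t]_x \int[gauss s]_e g (c + x + e)%R =
  \int[mu]_y (g y * (normal_pdf c (Num.sqrt (s ^+ 2 + t ^+ 2)) y)%:E).
Proof.
move=> s0 t0 mg g0.
wlog -> : c g mg g0 / c = 0%R => [hw|].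
  have := hw 0%R (fun x => g (c + x)%R) _ _ erefl.
  under eq_integral do under eq_integral do rewrite add0r addrA.
  move=> ->; last 2 first.
  - by apply: measurableT_comp => //; exact: measurable_shift.
  - by move=> x; exact: g0.
  rewrite -integral_gauss; last 2 first.
  - by apply: measurableT_comp => //; exact: measurable_shift.
  - by move=> x; exact: g0.
  rewrite integral_gauss_translation//.
  by rewrite gt_eqF// sqrtr_gt0 addr_gt0// exprn_gt0.
under eq_integral do rewrite add0r.
pose k (p : measurableTypeR R * measurableTypeR R) :=
  g p.2 * (normal_pdf p.1 s p.2 * normal_pdf 0 t p.1)%:E.
have mk : measurable_fun setT k.
  apply: emeasurable_funM.
    by apply: (@measurableT_comp _ _ _ _ (measurableTypeR R)) => //; exact: measurable_snd.
  apply/measurable_EFinP; apply: measurable_funM.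
    rewrite (_ : (fun _ => _) = (fun p => normal_pdf 0 s (p.2 - p.1)%R)).
      apply: (@measurableT_comp _ _ _ _ (measurableTypeR R)); first exact: measurable_normal_pdf.
      by apply: measurable_funB; [exact: measurable_snd|exact: measurable_fst].
    by apply/funext => p; rewrite !normal_pdfE ?gt_eqF// /normal_fun subr0.
  by apply: (@measurableT_comp _ _ _ _ (measurableTypeR R));
    [exact: measurable_normal_pdf|exact: measurable_fst].
have k0 p : 0 <= k p by rewrite mule_ge0// lee_fin mulr_ge0// normal_pdf_ge0.
have innerE x : (\int[gauss s]_e g (x + e)%R) * (normal_pdf 0 t x)%:E =
    \int[mu]_y k (x, y).
  rewrite integral_gauss_translation ?gt_eqF//.
  rewrite -ge0_integralZr//; last 3 first.
  - apply: emeasurable_funM => //; apply/measurable_EFinP.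
    exact: measurable_normal_pdf.
  - by move=> y _; rewrite mule_ge0// lee_fin normal_pdf_ge0.
  - by rewrite lee_fin normal_pdf_ge0.
  by apply: eq_integral => y _; rewrite /k EFinM muleA.
rewrite integral_gauss; last 2 first.
- apply: (@measurable_fun_fubini_tonelli_F _ _ R R R (gauss s)
    (fun p : R * R => g (p.1 + p.2)%R)) => //.
  by apply: measurableT_comp => //; exact: measurable_funD.
- by move=> x; apply: integral_ge0.
under eq_integral do rewrite innerE.
rewrite (fubini_tonelli k mk k0).
apply: eq_integral => y _ /=; rewrite /fubini_G /k/=.
under eq_integral do rewrite normal_pdf_mul_conv// EFinM muleA.
rewrite ge0_integralZl//.
- by rewrite integral_normal_pdf mule1.
- by apply/measurable_EFinP; exact: measurable_normal_pdf.
- by move=> x _; rewrite lee_fin normal_pdf_ge0.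
- by rewrite mule_ge0// lee_fin normal_pdf_ge0.
Qed.

End gauss_convolution.

Section observation_law.
Local Open Scope ereal_scope.
Context (R : realType).

Lemma measurable_addp : measurable_fun [set: R * R] (fun p : R * R => p.1 + p.2)%R.
Proof. exact: measurable_funD. Qed.
Definition addp (p : R * R) := (p.1 + p.2)%R.

HB.instance Definition _ := isMeasurableFun.Build _ _ _ _ addp measurable_addp.

Definition conv_prob (P Q : probability R R) : probability R R :=
  distribution (P \x Q)%E addp.

Lemma integral_conv_prob (P Q : probability R R) (g : R -> \bar R) :
  measurable_fun setT g -> (forall x, 0 <= g x) ->
  \int[conv_prob P Q]_x g x = \int[P]_x \int[Q]_y g (x + y)%R.
Proof.
move=> mg g0.
rewrite ge0_integral_distribution// fubini_tonelli1//=.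
by apply: measurableT_comp => //; exact: measurable_addp.
Qed.

Lemma measurable_observe2 n :
  measurable_fun [set: n.-tuple R * n.-tuple R]
    (fun p : n.-tuple R * n.-tuple R => observe p.1 p.2).
Proof.
apply/measurable_fun_tnthP => i.
rewrite (_ : _ \o _ = fun p : n.-tuple R * n.-tuple R => tnth p.1 i + tnth p.2 i)%R.
  by apply: measurable_funD; apply: measurableT_comp (measurable_tnth i) _.
by apply/funext => eps /=; rewrite tnth_mktuple.
Qed.

Lemma observe_consp n (x e : R) (xs es : n.-tuple R) :
  observe (consp (x, xs)) (consp (e, es)) = consp ((x + e)%R, observe xs es).
Proof.
apply: eq_from_tnth => i; rewrite tnth_mktuple.
have [j ->|->] := unliftP ord0 i; last by rewrite !tnth_consp0.
by rewrite !tnth_conspS tnth_mktuple.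
Qed.

(** A product prior observed through product noise is again a product law, so the Bayes mixtures
    stay i.i.d. and tensorize. *)
Lemma integral_observe_iid (P G : probability R R) n (f : n.-tuple R -> \bar R) :
  measurable_fun setT f -> (forall x, 0 <= f x) ->
  \int[iid_prob P n]_x \int[iid_prob G n]_e f (observe x e) =
  \int[iid_prob (conv_prob P G) n]_y f y.
Proof.
elim: n f => [|n IHn] f mf f0.
  have mc h : measurable_fun [set: 0.-tuple R] (h : _ -> \bar R).
    by rewrite (_ : h = cst (h [tuple]))//; apply/funext => x; rewrite tuple0.
  by rewrite !integral_iid_prob0// [observe _ _]tuple0.
have mo k : measurable_fun setT
    (fun p : k.-tuple R * k.-tuple R => observe p.1 p.2).
  exact: measurable_observe2.
rewrite [LHS]integral_iid_probS//; last 2 first.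
- apply: (@measurable_fun_fubini_tonelli_F _ _ _ _ R (iid_prob G n.+1)
    (fun p : n.+1.-tuple R * n.+1.-tuple R => f (observe p.1 p.2))) => //.
  by apply: measurableT_comp => //; exact: mo.
- by move=> x; apply: integral_ge0.
rewrite [RHS]integral_iid_probS//.
rewrite integral_conv_prob; last 2 first.
- apply: (@measurable_fun_fubini_tonelli_F _ _ _ _ R (iid_prob (conv_prob P G) n)
    (fun p : R * n.-tuple R => f (consp p))) => //.
  exact: measurableT_comp.
- by move=> x; apply: integral_ge0.
apply: eq_integral => x _.
transitivity (\int[iid_prob P n]_y \int[G]_e \int[iid_prob G n]_es
   f (consp ((x + e)%R, observe y es))).
  apply: eq_integral => y _.
  rewrite integral_iid_probS//; last first.
    by apply: measurableT_comp => //; exact: measurable_observe.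
  apply: eq_integral => e _; apply: eq_integral => es _.
  by rewrite observe_consp.
have mq : measurable_fun [set: (n.-tuple R * R) * n.-tuple R]
    (fun q => f (consp ((x + q.1.2)%R, observe q.1.1 q.2))).
  apply: measurableT_comp => //; apply: measurableT_comp => //.
  apply: measurable_fun_pair.
    apply: measurable_funD => //.
    by apply: measurableT_comp; [exact: measurable_snd|exact: measurable_fst].
  apply: (measurableT_comp (mo n) (g := fun q : (n.-tuple R * R) * n.-tuple R =>
    (q.1.1, q.2))).
  apply: measurable_fun_pair; last exact: measurable_snd.
  by apply: measurableT_comp; exact: measurable_fst.
(* The noise of the first coordinate is moved in front of the prior of the others, which makes the
   induction hypothesis applicable. *)
rewrite (fubini_tonelli (m1 := iid_prob P n) (m2 := G)
  (fun q => \int[iid_prob G n]_es f (consp ((x + q.2)%R, observe q.1 es)))); last 2 first.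
- apply: (@measurable_fun_fubini_tonelli_F _ _ _ _ R (iid_prob G n)
    (fun q : (n.-tuple R * R) * n.-tuple R => f (consp ((x + q.1.2)%R, observe q.1.1 q.2)))) => //.
- by move=> q; apply: integral_ge0.
apply: eq_integral => e _ /=.
rewrite (IHn (fun z => f (consp ((x + e)%R, z))))//.
apply: measurableT_comp => //.
apply: (measurableT_comp (f := @consp _ R n) (g := fun z => ((x + e)%R, z))) => //.
exact: measurable_fun_pair.
Qed.
End observation_law.

(** * Testing, Bayes risk and Chernoff bounds *)

Section iid_density.
Local Open Scope ereal_scope.
Context d (T : measurableType d) (R : realType) (P Q : probability T R).
Context (l : T -> R) (ml : measurable_fun setT l) (l0 : forall x, (0 <= l x)%R).
Hypothesis Ql : forall g : T -> \bar R, measurable_fun setT g ->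
  (forall x, 0 <= g x) -> \int[Q]_x g x = \int[P]_x (g x * (l x)%:E).

Lemma measurable_prod_tnth (h : T -> R) n : measurable_fun setT h ->
  measurable_fun setT (fun x : n.-tuple T => (\prod_(i < n) h (tnth x i))%R).
Proof.
move=> mh; apply: measurable_prod => i _.
by apply: measurableT_comp => //; exact: measurable_tnth.
Qed.

Lemma measurable_consp_l n (x : T) :
  measurable_fun [set: n.-tuple T] (fun z => consp (x, z)).
Proof.
apply: (measurableT_comp (f := @consp _ T n) (g := fun z => (x, z))) => //.
exact: measurable_fun_pair.
Qed.

Lemma integral_iid_density n (f : n.-tuple T -> \bar R) :
  measurable_fun setT f -> (forall x, 0 <= f x) ->
  \int[iid_prob Q n]_x f x =
  \int[iid_prob P n]_x (f x * (\prod_(i < n) l (tnth x i))%:E).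
Proof.
elim: n f => [|n IHn] f mf f0.
  have mc h : measurable_fun [set: 0.-tuple T] (h : _ -> \bar R).
    by rewrite (_ : h = cst (h [tuple]))//; apply/funext => x; rewrite tuple0.
  by rewrite !integral_iid_prob0// big_ord0 mule1.
have pl0 k (x : k.-tuple T) : (0 <= \prod_(i < k) l (tnth x i))%R.
  by apply: prodr_ge0 => i _; exact: l0.
have mpl k := @measurable_prod_tnth l k ml.
rewrite !integral_iid_probS//; last 2 first.
- apply: emeasurable_funM => //; apply/measurable_EFinP; exact: mpl.
- by move=> x; rewrite mule_ge0// lee_fin; exact: pl0.
rewrite Ql; last 2 first.
- apply: (@measurable_fun_fubini_tonelli_F _ _ _ _ R (iid_prob Q n)
    (fun p : T * n.-tuple T => f (consp p))) => //.
  exact: measurableT_comp.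
- by move=> x; apply: integral_ge0.
apply: eq_integral => x _.
rewrite IHn; last 2 first.
- by apply: measurableT_comp => //; exact: measurable_consp_l.
- by [].
rewrite -ge0_integralZr//; last 3 first.
- apply: emeasurable_funM; last by apply/measurable_EFinP; exact: mpl.
  by apply: measurableT_comp => //; exact: measurable_consp_l.
- by move=> y _; rewrite mule_ge0// lee_fin; exact: pl0.
- by rewrite lee_fin.
apply: eq_integral => y _; rewrite big_ord_recl tnth_consp0.
under [in RHS]eq_bigr do rewrite tnth_conspS.
by rewrite -muleA -EFinM mulrC.
Qed.

End iid_density.

Section two_point_testing.
Local Open Scope ereal_scope.
Context d (T : measurableType d) (R : realType) (P Q : probability T R).
Context (l : T -> R) (ml : measurable_fun setT l) (l0 : forall x, (0 <= l x)%R).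
Hypothesis Ql : forall g : T -> \bar R, measurable_fun setT g ->
  (forall x, 0 <= g x) -> \int[Q]_x g x = \int[P]_x (g x * (l x)%:E).

(** The two errors add up to at least the integral of min(1, l) = 1 - (1 - l)_+, and (1 - l)_+ is at
    most lam + (l - 1)^2 / lam. As l integrates to 1, the integral of (l - 1)^2 is at most E. *)
Lemma testing_chi2 (E lam : R) (A : set T) : (0 < lam)%R -> measurable A ->
  \int[P]_x ((l x) ^+ 2)%:E <= (1 + E)%:E ->
  (1 - lam - E / lam)%:E <= P A + Q (~` A).
Proof.
move=> lam0 mA chi.
have mAC : measurable (~` A) by exact: measurableC.
have PA : P A = \int[P]_x (\1_A x)%:E by rewrite integral_indic// setIT.
have QA : Q (~` A) = \int[P]_x ((\1_(~` A) x)%:E * (l x)%:E).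
  rewrite -Ql; last 2 first.
  - by apply/measurable_EFinP; exact: measurable_indic.
  - by move=> x; rewrite lee_fin.
  by rewrite integral_indic// setIT.
have l1 : \int[P]_x (l x)%:E = 1.
  rewrite -(integral_prob1 Q) (Ql (g := cst 1))//.
  by apply: eq_integral => x _; rewrite mul1e.
have ml1 : measurable_fun setT (fun x => (l x)%:E) by exact/measurable_EFinP.
have ml2 : measurable_fun setT (fun x => (l x ^+ 2)%:E).
  by apply/measurable_EFinP; exact: measurable_funX.
have mi (B : set T) : measurable B -> measurable_fun setT (fun x : T => (\1_B x : R)%:E).
  by move=> mB; apply/measurable_EFinP; exact: measurable_indic.
have mil : measurable_fun setT (fun x => (\1_(~` A) x)%:E * (l x)%:E).
  by apply: emeasurable_funM => //; exact: mi.
(* The negative cross term of the expanded square is put on the left, so that both integrands are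
   nonnegative and can be split term by term. *)
have key : \int[P]_x (1 + (2 / lam)%:E * (l x)%:E) <=
   \int[P]_x (((\1_A x)%:E + (\1_(~` A) x)%:E * (l x)%:E) +
    ((lam + lam^-1)%:E + (lam^-1)%:E * (l x ^+ 2)%:E)).
  apply: ge0_le_integral => //.
  - by move=> x _; rewrite adde_ge0// mule_ge0 ?lee_fin// divr_ge0// ltW.
  - by apply: emeasurable_funD => //; exact: emeasurable_funM.
  - apply: emeasurable_funD; first by apply: emeasurable_funD => //; exact: mi.
    by apply: emeasurable_funD => //; exact: emeasurable_funM.
  move=> x _; rewrite -!EFinM -!EFinD lee_fin.
  have e1 : (\1_A x + \1_(~` A) x * l x >= 1 - Num.max 0 (1 - l x))%R.
    rewrite !indicE in_setC; case: (x \in A) => /=; rewrite ?mul0r ?mul1r ?addr0 ?add0r.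
      by rewrite gerBl le_max lexx.
    by rewrite lerBlDr addrC -lerBlDr le_max lexx orbT.
  (* AM-GM, which avoids the Cauchy-Schwarz inequality for the total variation *)
  have e2 : (Num.max 0 (1 - l x) <= lam + lam^-1 * (l x - 1) ^+ 2)%R.
    rewrite ge_max; apply/andP; split.
      apply: addr_ge0; first exact: ltW.
      by apply: mulr_ge0; [rewrite invr_ge0 ltW|exact: sqr_ge0].
    rewrite -(ler_pM2l lam0) [leRHS]mulrDr mulVKf ?gt_eqF//.
    by have := sqr_ge0 (lam - (1 - l x) / 2); have := sqr_ge0 (1 - l x); lra.
  have := lerD e1 e2; have -> : (lam^-1 * (l x - 1) ^+ 2 =
    lam^-1 * l x ^+ 2 - 2 / lam * l x + lam^-1)%R by field; rewrite gt_eqF.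
  lra.
have li : (0 <= lam^-1)%R by rewrite invr_ge0 ltW.
move: key.
rewrite ge0_integralD//; last 2 first.
- by move=> x _; rewrite mule_ge0 ?lee_fin// divr_ge0// ltW.
- exact: emeasurable_funM.
rewrite integral_prob1 ge0_integralZl//; last 2 first.
- by move=> x _; rewrite lee_fin.
- by rewrite lee_fin divr_ge0// ltW.
rewrite l1 mule1.
rewrite ge0_integralD//; last 4 first.
- move=> x _; apply: adde_ge0; first by rewrite lee_fin.
  by apply: mule_ge0; rewrite lee_fin.
- by apply: emeasurable_funD => //; exact: mi.
- move=> x _; apply: adde_ge0; first by rewrite lee_fin addr_ge0// ltW.
  by apply: mule_ge0; rewrite lee_fin ?sqr_ge0.
- by apply: emeasurable_funD => //; exact: emeasurable_funM.
rewrite ge0_integralD//; last 3 first.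
- by move=> x _; rewrite lee_fin addr_ge0// ltW.
- by move=> x _; apply: mule_ge0; rewrite lee_fin ?sqr_ge0.
- exact: emeasurable_funM.
rewrite ge0_integralD//; last 2 first.
- exact: mi.
- by move=> x _; apply: mule_ge0; rewrite lee_fin.
rewrite -PA -QA.
have -> : \int[P]_x (lam + lam^-1)%:E = (lam + lam^-1)%:E.
  by rewrite integral_cst// [X in _ * X](probability_setT P) mule1.
rewrite ge0_integralZl//; last by move=> x _; rewrite lee_fin sqr_ge0.
have : (lam^-1)%:E * \int[P]_x (l x ^+ 2)%:E <= (lam^-1)%:E * (1 + E)%:E.
  by rewrite lee_wpmul2l// lee_fin.
move=> h1 h2.
have {h1 h2} := le_trans h2 (leeD2l _ (leeD2l _ h1)).
have : P A \is a fin_num by exact: fin_num_measure.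
have : Q (~` A) \is a fin_num by exact: fin_num_measure.
move: (P A) (Q (~` A)) => [p| |] [q| |]// _ _.
rewrite -!EFinM -!EFinD !lee_fin.
by set li2 := (lam^-1)%R => h; lra.
Qed.

End two_point_testing.

Section iid_testing.
Local Open Scope ereal_scope.
Context d (T : measurableType d) (R : realType) (P Q : probability T R).
Context (l : T -> R) (ml : measurable_fun setT l) (l0 : forall x, (0 <= l x)%R).
Hypothesis Ql : forall g : T -> \bar R, measurable_fun setT g ->
  (forall x, 0 <= g x) -> \int[Q]_x g x = \int[P]_x (g x * (l x)%:E).

(** The second moment of the product likelihood ratio is the n-th power of that of one coordinate,
    and (1 + x)^n <= e^(n x). *)
Lemma iid_testing_chi2 n (x lam : R) (A : set (n.-tuple T)) :
  (0 < lam)%R -> (0 <= x)%R -> measurable A ->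
  \int[P]_x ((l x) ^+ 2)%:E <= (1 + x)%:E ->
  (1 - lam - (expR (n%:R * x) - 1) / lam)%:E
    <= iid_prob P n A + iid_prob Q n (~` A).
Proof.
move=> lam0 x0 mA chi.
apply: (testing_chi2 (l := fun y : n.-tuple T => (\prod_(i < n) l (tnth y i))%R)) => //.
- exact: measurable_prod_tnth.
- by move=> y; apply: prodr_ge0 => i _; exact: l0.
- by move=> g mg g0; exact: integral_iid_density.
under eq_integral do rewrite -prodrXl -prodEFin.
rewrite (@integral_iid_prob_prod _ _ _ P (fun x => (l x ^+ 2)%:E)); last 2 first.
- by apply/measurable_EFinP; exact: measurable_funX.
- by move=> y; rewrite lee_fin sqr_ge0.
rewrite addrC subrK.
have : 0 <= \int[P]_x (l x ^+ 2)%:E.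
  by apply: integral_ge0 => y _; rewrite lee_fin sqr_ge0.
move: (\int[P]_x _) chi => [r| |]//; rewrite !lee_fin => rx r0.
rewrite -EFin_expe lee_fin expRM_natl.
apply: lerXn2r; rewrite ?nnegrE ?expR_ge0//.
by apply: le_trans rx _; exact: expR_ge1Dx.
Qed.

End iid_testing.

Section bayes.
Local Open Scope ereal_scope.
Context (R : realType) (n : nat).

Lemma nnsup_ub (A : set (\bar R)) a : A a -> a <= nnsup A.
Proof. by move=> Aa; apply: ereal_sup_ubound; right. Qed.

Lemma nnsup_ge0 (A : set (\bar R)) : 0 <= nnsup A.
Proof. by apply: ereal_sup_ubound; left. Qed.

(** The priors have independent coordinates and may leave the hypothesis: on E the error is bounded
    by the supremum, off E by 1, which costs the prior mass outside E. *)
Lemma bayes_risk_le (A E : set (n.-tuple R)) (J : set R) (s : R)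
    (Pi : probability R R) (B : set (n.-tuple R)) :
  measurable B -> measurable E -> E `<=` A -> J s ->
  iid_prob (conv_prob Pi (gauss s)) n B <=
  nnsup [set lawY p.1 p.2 B | p in A `*` J] + iid_prob Pi n (~` E).
Proof.
move=> mB mE EA Js.
set S := nnsup _.
have S0 : 0 <= S by exact: nnsup_ge0.
have mEC : measurable (~` E) by exact: measurableC.
have mB1 : measurable_fun setT (fun y : n.-tuple R => (\1_B y : R)%:E).
  by apply/measurable_EFinP; exact: measurable_indic.
have lawE theta : lawY theta s B =
    \int[iid_prob (gauss s) n]_e (\1_B (observe theta e))%:E.
  have mo : measurable (observe theta @^-1` B).
    by rewrite -[X in measurable X]setTI; exact: measurable_observe.
  rewrite (eq_integral (fun e => (\1_(observe theta @^-1` B) e)%:E))//.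
  by rewrite integral_indic// setIT.
have -> : iid_prob (conv_prob Pi (gauss s)) n B =
    \int[iid_prob Pi n]_theta lawY theta s B.
  rewrite -[in LHS](setIT B) -integral_indic//.
  rewrite -(@integral_observe_iid _ Pi (gauss s) n (fun y => (\1_B y)%:E))//.
  by apply: eq_integral => theta _; rewrite lawE.
have <- : \int[iid_prob Pi n]_theta (S + (\1_(~` E) theta)%:E) =
    S + iid_prob Pi n (~` E).
  rewrite ge0_integralD//; last first.
    by apply/measurable_EFinP; exact: measurable_indic.
  rewrite integral_indic// setIT; congr (_ + _).
  by rewrite integral_cst// [X in _ * X](probability_setT (iid_prob Pi n)) mule1.
apply: ge0_le_integral => //.
- under eq_fun do rewrite lawE.
  apply: (@measurable_fun_fubini_tonelli_F _ _ _ _ R (iid_prob (gauss s) n)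
    (fun p : n.-tuple R * n.-tuple R => (\1_B (observe p.1 p.2))%:E)) => //.
  apply: (measurableT_comp mB1); exact: measurable_observe2.
- apply: emeasurable_funD => //.
  by apply/measurable_EFinP; exact: measurable_indic.
move=> theta _; have [Et|Et] := boolP (theta \in E).
  apply: (@le_trans _ _ S); last by rewrite leeDl// lee_fin.
  by apply: nnsup_ub; exists (theta, s) => //; split => //; apply: EA; rewrite -inE.
rewrite indicE in_setC Et/=.
apply: (@le_trans _ _ 1); last by rewrite leeDr.
exact: probability_le1.
Qed.

End bayes.

Lemma expR1_le3 (R : realType) : expR 1 <= 3 :> R.
Proof.
(* From e^(-1/6) >= 5/6; the sixth power of 6/5 is about 2.986. *)
have h : expR (6^-1) <= 6 / 5 :> R.
  have := expR_ge1Dx (- 6^-1 : R); rewrite expRN => h.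
  rewrite -[expR _]invrK -[6 / 5]invrK lef_pV2 ?posrE ?invr_gt0 ?expR_gt0//.
  by apply: le_trans h; rewrite invf_div; lra.
have -> : (1 = 6%:R * 6^-1 :> R) by rewrite mulfV.
rewrite expRM_natl; apply: (@le_trans _ _ ((6 / 5) ^+ 6)).
  by apply: lerXn2r => //; rewrite nnegrE ?expR_ge0.
by rewrite !exprS expr0; lra.
Qed.

Section chernoff.
Local Open Scope ereal_scope.
Context d (T : measurableType d) (R : realType) (P : probability T R).
Context (C : set T) (mC : measurable C).

Definition hits n (x : n.-tuple T) := #|[set i : 'I_n | tnth x i \in C]%SET|.

Lemma expR_hits n (t : R) (x : n.-tuple T) :
  expR (t * (hits x)%:R) = (\prod_(i < n) (1 + (expR t - 1) * \1_C (tnth x i)))%R.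
Proof.
rewrite expRM_natr /hits -prodr_const.
rewrite big_mkcond; apply: eq_bigr => i _.
rewrite inE indicE; case: (_ \in C); rewrite ?mulr0 ?mulr1 ?addr0//.
by rewrite addrC subrK.
Qed.

Lemma measurable_hits n : measurable_fun setT (fun x : n.-tuple T => (hits x)%:R : R).
Proof.
rewrite (_ : (fun _ => _) = fun x : n.-tuple T => (\sum_(i < n) \1_C (tnth x i))%R).
  apply: measurable_sum => i.
  apply: (@measurableT_comp _ _ _ _ _ _ (\1_C : T -> R) _ (fun x : n.-tuple T => tnth x i)).
    exact: measurable_indic.
  exact: measurable_tnth.
apply/funext => x; rewrite /hits -sum1_card natr_sum big_mkcond/=.
apply: eq_bigr => i _; rewrite inE indicE.
by case: (_ \in C).
Qed.

Lemma integral_expR_hits n (t q : R) : P C = q%:E ->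
  \int[iid_prob P n]_x (expR (t * (hits x)%:R))%:E =
  ((1 + (expR t - 1) * q) ^+ n)%:E.
Proof.
move=> PC.
under eq_integral do rewrite expR_hits -prodEFin.
have g0 x : (0 <= 1 + (expR t - 1) * \1_C x :> R)%R.
  rewrite indicE; case: (_ \in C); rewrite ?mulr0 ?addr0// mulr1 addrC subrK.
  exact: expR_ge0.
rewrite (@integral_iid_prob_prod _ _ _ P (fun x => (1 + (expR t - 1) * \1_C x)%:E)); last 2 first.
- apply/measurable_EFinP; apply: measurable_funD => //; exact: measurable_funM.
- by move=> x; rewrite lee_fin.
rewrite EFin_expe; congr (_ ^+ _).
have PCC : P (~` C) = (1 - q)%:E by rewrite probability_setC// PC.
rewrite (eq_integral (fun x => (expR t)%:E * (\1_C x)%:E + (\1_(~` C) x)%:E)).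
  have mi (B : set T) : measurable B ->
      measurable_fun setT (fun x : T => (\1_B x : R)%:E).
    by move=> mB; apply/measurable_EFinP; exact: measurable_indic.
  have ge0i (B : set T) x : setT x -> 0 <= (\1_B x : R)%:E by rewrite lee_fin.
  have mC' : measurable (~` C) by exact: measurableC.
  rewrite ge0_integralD; [|by []| | |exact: ge0i|exact: mi]; last 2 first.
  - by move=> x _; rewrite mule_ge0 ?ge0i// lee_fin expR_ge0.
  - by apply: emeasurable_funM => //; exact: mi.
  rewrite ge0_integralZl; [|by []|exact: mi|exact: ge0i|by rewrite lee_fin expR_ge0].
  rewrite !integral_indic ?setIT//.
  rewrite [X in _ * X]PC [X in _ + X]PCC.
  by rewrite -EFinM -EFinD; congr (_%:E); ring.
move=> x _; rewrite -EFinM -EFinD; congr (_%:E).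
by rewrite !indicE in_setC; case: (_ \in C) => /=; ring.
Qed.

Lemma markov_integral d' (T' : measurableType d') (Q : probability T' R)
    (S : set T') (f : T' -> R) : measurable S -> measurable_fun setT f ->
  (forall x, (0 <= f x)%R) -> (forall x, S x -> (1 <= f x)%R) ->
  Q S <= \int[Q]_x (f x)%:E.
Proof.
move=> mS mf f0 f1; rewrite -[in leLHS](setIT S) -integral_indic//.
apply: ge0_le_integral => //.
- by apply/measurable_EFinP; exact: measurable_indic.
- by apply/measurable_EFinP.
move=> x _; rewrite lee_fin indicE; case: (boolP (x \in S)) => //= xS.
by apply: f1; rewrite -inE.
Qed.

Lemma measurable_hits_le n (K : R) :
  measurable [set x : n.-tuple T | ((hits x)%:R <= K)%R].
Proof.
rewrite (_ : [set _ | _] = (fun x : n.-tuple T => (hits x)%:R : R) @^-1` `]-oo, K]).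
  by rewrite -[X in measurable X]setTI; exact: measurable_hits.
by apply/seteqP; split => x /=; rewrite in_itv.
Qed.

Lemma measurable_hits_ge n (K : R) :
  measurable [set x : n.-tuple T | (K <= (hits x)%:R)%R].
Proof.
rewrite (_ : [set _ | _] = (fun x : n.-tuple T => (hits x)%:R : R) @^-1` `[K, +oo[).
  by rewrite -[X in measurable X]setTI; exact: measurable_hits.
by apply/seteqP; split => x /=; rewrite in_itv/= ?andbT.
Qed.

(** Exponential Markov with t = 1: since e - 1 <= 2, the moment generating function is at most e^(2
    n q) <= e^(K/2). *)
Lemma hits_upper_tail n (q K : R) : P C = q%:E -> (4 * (n%:R * q) <= K)%R ->
  iid_prob P n (~` [set x | (hits x)%:R <= K]%R) <= (expR (- (K / 2)))%:E.
Proof.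
move=> PC qK.
have q0 : (0 <= q)%R by rewrite -lee_fin -PC.
apply: (@le_trans _ _ (\int[iid_prob P n]_x (expR (- K) * expR (1 * (hits x)%:R))%:E)).
  apply: markov_integral.
  - by apply: measurableC; exact: measurable_hits_le.
  - apply: measurable_funM => //; apply: measurableT_comp => //.
    by apply: measurable_funM => //; exact: measurable_hits.
  - by move=> x; rewrite mulr_ge0 ?expR_ge0.
  - move=> x /= /negP; rewrite -ltNge => Kx.
    by rewrite -expRD -[leLHS]expR0 ler_expR; lra.
under eq_integral do rewrite EFinM.
rewrite ge0_integralZl; [|by []| |by move=> x _; rewrite lee_fin expR_ge0|
  by rewrite lee_fin expR_ge0]; last first.
  apply/measurable_EFinP; apply: measurableT_comp => //.
  by apply: measurable_funM => //; exact: measurable_hits.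
rewrite (@integral_expR_hits n _ _ PC) -EFinM lee_fin.
have e3 : (expR 1 <= 3 :> R)%R by exact: expR1_le3.
have : ((1 + (expR 1 - 1) * q) ^+ n <= expR (2 * (n%:R * q)))%R.
  rewrite mulrCA expRM_natl; apply: lerXn2r; rewrite ?nnegrE ?expR_ge0//.
    by rewrite addr_ge0// mulr_ge0//; have := expR_ge1Dx (1 : R); lra.
  apply: (@le_trans _ _ (1 + 2 * q)%R); last exact: expR_ge1Dx.
  by rewrite lerD2l ler_wpM2r//; lra.
move=> h; apply: (le_trans (ler_wpM2l (expR_ge0 (- K)) h)).
by rewrite -expRD ler_expR; lra.
Qed.

(** Exponential Markov with t = -1: since e^(-1) <= 1/2, the generating function is at most e^(-n q
    / 2) <= e^(-2N). *)
Lemma hits_lower_tail n (q N : R) : P C = q%:E -> (4 * N <= n%:R * q)%R ->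
  iid_prob P n (~` [set x | N <= (hits x)%:R]%R) <= (expR (- N))%:E.
Proof.
move=> PC qN.
have q0 : (0 <= q)%R by rewrite -lee_fin -PC.
have q1 : (q <= 1)%R by rewrite -lee_fin -PC probability_le1.
apply: (@le_trans _ _ (\int[iid_prob P n]_x (expR N * expR (-1 * (hits x)%:R))%:E)).
  apply: markov_integral.
  - by apply: measurableC; exact: measurable_hits_ge.
  - apply: measurable_funM => //; apply: measurableT_comp => //.
    by apply: measurable_funM => //; exact: measurable_hits.
  - by move=> x; rewrite mulr_ge0 ?expR_ge0.
  - move=> x /= /negP; rewrite -ltNge => Kx.
    by rewrite -expRD -[leLHS]expR0 ler_expR; lra.
under eq_integral do rewrite EFinM.
rewrite ge0_integralZl; [|by []| |by move=> x _; rewrite lee_fin expR_ge0|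
  by rewrite lee_fin expR_ge0]; last first.
  apply/measurable_EFinP; apply: measurableT_comp => //.
  by apply: measurable_funM => //; exact: measurable_hits.
rewrite (@integral_expR_hits n _ _ PC) -EFinM lee_fin.
have e2 : (expR (-1) <= 1 / 2 :> R)%R.
  by rewrite expRN -div1r ler_pM2l// lef_pV2 ?posrE ?expR_gt0//; have := expR_ge1Dx (1 : R); lra.
have e0 := expR_ge0 (-1 : R).
have : ((1 + (expR (-1) - 1) * q) ^+ n <= expR (- (1 / 2) * (n%:R * q)))%R.
  rewrite mulrCA expRM_natl; apply: lerXn2r; rewrite ?nnegrE ?expR_ge0//.
    by have := mulr_ge0 e0 q0; lra.
  apply: (@le_trans _ _ (1 + - (1 / 2) * q)%R); last exact: expR_ge1Dx.
  by rewrite lerD2l ler_wpM2r//; lra.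
move=> h; apply: (le_trans (ler_wpM2l (expR_ge0 N) h)).
by rewrite -expRD ler_expR; lra.
Qed.

End chernoff.

(** * Moment matching and the chi-square bound *)

Section exp_taylor.
Context (R : realType).
Implicit Types (u x : R).

Definition exp_trunc (n : nat) (u : R) := \sum_(k < n) u ^+ k / k`!%:R.

Lemma series_exp_coeffE u n : series (exp_coeff u) n = exp_trunc n u.
Proof. by rewrite /series/= big_mkord. Qed.

Lemma exp_trunc_le n u : 0 <= u -> exp_trunc n u <= expR u.
Proof.
move=> u0; rewrite -series_exp_coeffE; apply: nondecreasing_cvgn_le.
  apply: nondecreasing_series => k _ _; exact: exp_coeff_ge0.
exact: is_cvg_series_exp_coeff.
Qed.

Lemma leq_fact_mul n j : (n`! * j`! <= (n + j)`!)%N.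
Proof. by rewrite -(bin_fact (leq_addr j n)) addKn leq_pmull// bin_gt0 leq_addr. Qed.

(** By n! j! <= (n + j)!, every partial tail is at most |u|^n / n! times a partial sum of e^|u|;
    then the limit is taken. *)
Lemma exp_taylor n u :
  `|expR u - exp_trunc n u| <= `|u| ^+ n / n`!%:R * expR `|u|.
Proof.
have cv : (fun N => `|exp_trunc (N + n) u - exp_trunc n u|) @ \oo -->
    `|expR u - exp_trunc n u|.
  apply: cvg_norm; apply: cvgB; last exact: cvg_cst.
  have := @is_cvg_series_exp_coeff R u.
  rewrite -(cvg_shiftn n).
  by under eq_fun do rewrite /= series_exp_coeffE.
apply: (cvgr_to_le cv); apply: nearW => N.
rewrite addnC {1}/exp_trunc big_split_ord/= addrAC subrr add0r.
apply: le_trans (ler_norm_sum _ _ _) _.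
apply: (@le_trans _ _ (`|u| ^+ n / n`!%:R * exp_trunc N `|u|)); last first.
  by rewrite ler_wpM2l ?exp_trunc_le// divr_ge0// exprn_ge0.
rewrite /exp_trunc mulr_sumr; apply: ler_sum => j _.
rewrite normrM normfV normrX normr_nat exprD mulrACA -invfM.
rewrite ler_wpM2l ?mulr_ge0 ?exprn_ge0//.
rewrite lef_pV2 ?posrE ?mulr_gt0 ?ltr0n ?fact_gt0//.
by rewrite -natrM ler_nat leq_fact_mul.
Qed.

(** A single term of the series of e^(x/r). The free parameter r converts a bound on x into
    geometric decay in n. *)
Lemma pow_div_fact_le n x (r : R) : 0 <= x -> 0 < r ->
  x ^+ n / n`!%:R <= r ^+ n * expR (x / r).
Proof.
move=> x0 r0.
have -> : x ^+ n / n`!%:R = r ^+ n * ((x / r) ^+ n / n`!%:R).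
  by rewrite mulrA; congr (_ / _); rewrite expr_div_n mulrC divfK// expf_neq0// gt_eqF.
apply: ler_wpM2l; first by rewrite exprn_ge0// ltW.
have xr : 0 <= x / r by rewrite divr_ge0// ltW.
apply: (le_trans _ (exp_trunc_le n.+1 xr)).
rewrite /exp_trunc big_ord_recr/= lerDr sumr_ge0// => i _.
by rewrite divr_ge0// exprn_ge0.
Qed.

End exp_taylor.

Section central_binomial.
Context (R : realType).
Implicit Types (x : R).

(* The Taylor coefficients of (1 - x)^(-1/2). *)
Definition cbin (j : nat) : R := (j.*2)`!%:R / (4 ^+ j * (j`!%:R) ^+ 2).

Lemma cbin0 : cbin 0 = 1.
Proof. by rewrite /cbin double0 fact0 expr0 mul1r expr1n divr1. Qed.

Lemma cbin_ge0 j : 0 <= cbin j.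
Proof. by rewrite /cbin divr_ge0// mulr_ge0// exprn_ge0. Qed.

Lemma cbinS i : i.+1%:R * cbin i.+1 = (i%:R + 1 / 2) * cbin i.
Proof.
rewrite /cbin doubleS !factS exprS !natrM.
have f0 : (i`!%:R != 0 :> R) by rewrite pnatr_eq0 -lt0n fact_gt0.
have i0 : (i%:R + 1 != 0 :> R) by rewrite natr1 pnatr_eq0.
have e0 : (4 ^+ i != 0 :> R) by rewrite expf_neq0.
rewrite -!natr1 -muln2 natrM.
by field; rewrite f0 i0 expf_neq0//; apply/eqP; lra.
Qed.

(** The square of (1 - x)^(-1/2) is the geometric series. In coefficients: the sum weighted by i is
    computed once by the symmetry i <-> l - i ([half]) and once by the recurrence [cbinS], and
    comparison gives the induction step. *)
Lemma cbin_conv l : \sum_(i < l.+1) cbin i * cbin (l - i) = 1.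
Proof.
elim: l => [|l IHl]; first by rewrite big_ord_recl big_ord0 subnn cbin0 mulr1 addr0.
set S := \sum_(i < l.+2) _.
have symm k (F : nat -> R) : \sum_(i < k.+1) F i * (cbin i * cbin (k - i)) =
    \sum_(i < k.+1) F (k - i)%N * (cbin i * cbin (k - i)).
  rewrite (reindex_inj rev_ord_inj)/=; apply: eq_bigr => i _.
  have ik : (i <= k)%N by rewrite -ltnS.
  by rewrite subSS subKn; [congr (_ * _); exact: mulrC|exact: ik].
have half k : \sum_(i < k.+1) i%:R * (cbin i * cbin (k - i)) =
    k%:R / 2 * \sum_(i < k.+1) (cbin i * cbin (k - i)).
  have : \sum_(i < k.+1) i%:R * (cbin i * cbin (k - i)) +
     \sum_(i < k.+1) i%:R * (cbin i * cbin (k - i)) =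
     k%:R * \sum_(i < k.+1) (cbin i * cbin (k - i)).
    rewrite {2}(symm k (fun i => i%:R)) -big_split/= mulr_sumr.
    apply: eq_bigr => i _; rewrite -mulrDl -natrD subnKC// -ltnS//.
  by move=> h; lra.
have hS := half l.+1.
have : \sum_(i < l.+2) i%:R * (cbin i * cbin (l.+1 - i)) = (l%:R + 1) / 2.
  rewrite big_ord_recl mul0r add0r.
  rewrite (eq_bigr (fun i : 'I_l.+1 => i%:R * (cbin i * cbin (l - i)) +
    1 / 2 * (cbin i * cbin (l - i)))); last first.
    by move=> i _; rewrite lift0 subSS mulrA cbinS -mulrDl mulrA.
  by rewrite big_split/= half IHl -mulr_sumr IHl; lra.
rewrite hS -/S -natr1 => h.
have l0 : (l%:R + 1) / 2 != 0 :> R by rewrite mulf_neq0// natr1 pnatr_eq0.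
by apply: (mulfI l0); rewrite h mulr1.
Qed.

(** Up to degree m the squared truncation has coefficients 1 by [cbin_conv]; the later ones are
    nonnegative. *)
Lemma sqr_sum_cbin_ge m x : 0 <= x ->
  \sum_(l < m.+1) x ^+ l <= (\sum_(j < m.+1) cbin j * x ^+ j) ^+ 2.
Proof.
move=> x0; pose p : {poly R} := \poly_(j < m.+1) cbin j.
have <- : p.[x] = \sum_(j < m.+1) cbin j * x ^+ j by exact: horner_poly.
rewrite -horner_exp expr2.
have sz : (size (p * p)%R <= (m.+1 + m.+1))%N.
  apply: leq_trans (size_polyMleq _ _) _; apply: leq_trans (leq_pred _) _.
  by apply: leq_add; exact: size_poly.
rewrite (horner_coef_wide _ sz) big_split_ord/= -[leLHS]addr0; apply: lerD.
  apply: ler_sum => i _; rewrite coefM.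
  rewrite (eq_bigr (fun j : 'I_i.+1 => cbin j * cbin (i - j))) ?cbin_conv ?mul1r//.
  move=> j _; rewrite !coef_poly.
  have ji : (j <= i)%N by rewrite -ltnS.
  rewrite (leq_ltn_trans ji)// (leq_ltn_trans (leq_subr _ _))//.
apply: sumr_ge0 => i _; rewrite mulr_ge0 ?exprn_ge0// coefM.
apply: sumr_ge0 => j _; rewrite !coef_poly mulr_ge0//; case: ifP => // _; exact: cbin_ge0.
Qed.

(** Squaring reduces the claim to the geometric sum: with s = sqrt(1 - x) and y = x^(m+1), (s S)^2
    >= 1 - y and hence s S >= 1 - y. The factor 2 is the bound on 1/s for x <= 1/2. *)
Lemma inv_sqrt_onem_le m x : 0 <= x <= 1 / 2 ->
  (Num.sqrt (1 - x))^-1 <= \sum_(j < m.+1) cbin j * x ^+ j + 2 * x ^+ m.+1.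
Proof.
move=> /andP[x0 x12].
set S := \sum_(j < m.+1) _; set s := Num.sqrt _.
have x1 : 0 < 1 - x by lra.
have s0 : 0 < s by rewrite sqrtr_gt0.
have s2 : s ^+ 2 = 1 - x by rewrite sqr_sqrtr// ltW.
have s12 : 1 / 2 <= s by rewrite -(@ler_pXn2r _ 2)// ?nnegrE ?ltW// s2; lra.
have S0 : 0 <= S by apply: sumr_ge0 => i _; rewrite mulr_ge0 ?cbin_ge0 ?exprn_ge0.
set y := x ^+ m.+1.
have y0 : 0 <= y by rewrite exprn_ge0.
have y1 : y <= 1 by rewrite exprn_ile1//; lra.
have sS : 1 - y <= s * S.
  have h : 1 - y <= (s * S) ^+ 2.
    rewrite exprMn s2; apply: (@le_trans _ _ ((1 - x) * \sum_(l < m.+1) x ^+ l)).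
      by rewrite -[leLHS]opprB subrX1 -mulNr opprB.
    by apply: ler_wpM2l; [exact: ltW|exact: sqr_sum_cbin_ge].
  have := mulr_ge0 (ltW s0) S0.
  move: (s * S) h => z h z0.
  rewrite leNgt; apply/negP => zy.
  have : z ^+ 2 < (1 - y) ^+ 2 by rewrite ltr_pXn2r// ?nnegrE; lra.
  nra.
rewrite -[_^-1]mul1r ler_pdivrMr//.
have : y <= 2 * y * s by nra.
nra.
Qed.

End central_binomial.

Section moment_matching.
Context (R : realType).

(* The 2j-th moment of a centered Gaussian of "variance" -tau. *)
Definition gmom (tau : R) (j : nat) : R :=
  (- tau) ^+ j * (j.*2)`!%:R / (2 ^+ j * j`!%:R).

Lemma fact_neq0 n : n`!%:R != 0 :> R.
Proof. by rewrite pnatr_eq0 -lt0n fact_gt0. Qed.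

(** This identifies the matched part of the Hermite expansion with the truncated series of (1 -
    tau^2)^(-1/2), the closed form occurring in the chi-square divergence. *)
Lemma sqr_gmom tau j : gmom tau j ^+ 2 / (j.*2)`!%:R = cbin R j * (tau ^+ 2) ^+ j.
Proof.
rewrite /gmom /cbin.
have -> : (4 : R) ^+ j = (2 ^+ j) ^+ 2 by rewrite exprAC; congr (_ ^+ _); lra.
have -> : (tau ^+ 2) ^+ j = ((- tau) ^+ j) ^+ 2 by rewrite [RHS]exprAC sqrrN.
have h1 := fact_neq0 j; have h2 := fact_neq0 j.*2.
have h3 : (2 : R) ^+ j != 0 by rewrite expf_neq0.
move: (j.*2)`!%:R (j`!%:R) ((- tau) ^+ j) h1 h2 => x y z y0 x0.
move: ((2 : R) ^+ j) h3 => w w0.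
by field; rewrite w0 x0 y0.
Qed.

Lemma gmom_div_fact tau j : gmom tau j / (j.*2)`!%:R = (- (tau / 2)) ^+ j / j`!%:R.
Proof.
rewrite /gmom -mulNr expr_div_n.
have h1 := fact_neq0 j; have h2 := fact_neq0 j.*2.
have h3 : (2 : R) ^+ j != 0 by rewrite expf_neq0.
move: (j.*2)`!%:R (j`!%:R) ((- tau) ^+ j) h1 h2 => x y z y0 x0.
move: ((2 : R) ^+ j) h3 => w w0.
by field; rewrite w0 x0 y0.
Qed.

Lemma big_even_odd n (f : nat -> R) :
  \sum_(k < n.*2) f k = \sum_(j < n) (f j.*2 + f j.*2.+1).
Proof.
elim: n => [|n IHn]; first by rewrite !big_ord0.
by rewrite doubleS !big_ord_recr/= IHn addrA.
Qed.

Context (I : finType) (c a : I -> R) (beta tau b A : R) (m : nat).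
Hypothesis beta01 : 0 <= beta <= 1.
Hypothesis tau012 : 0 <= tau <= 1 / 2.
Hypothesis ab : forall i, `|a i| <= b.
Hypothesis cA : \sum_i `|c i| * `|a i| ^+ (m.+1).*2 <= A.
Hypothesis even_match : forall j, (j <= m)%N ->
  \sum_i c i * a i ^+ j.*2 = - beta * gmom tau j.
Hypothesis odd_match : forall j, (j <= m)%N ->
  \sum_i c i * a i ^+ j.*2.+1 = 0.

Let S := \sum_(j < m.+1) cbin R j * (tau ^+ 2) ^+ j.

Let b0 (i : I) : 0 <= b. Proof. by apply: le_trans (ab i). Qed.

(** Truncating the exponential after m + 1 terms leaves even moments up to order 2m, which
    [even_match] evaluates; the remainder is paid by the absolute moment A. *)
Lemma cross_term_le :
  \sum_i c i * expR (- (tau / 2 * a i ^+ 2)) <=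
  - beta * S + A * (tau / 2) ^+ m.+1 / m.+1`!%:R * expR (b ^+ 2).
Proof.
have /andP[tau0 tau12] := tau012.
have -> : - beta * S = \sum_i c i * exp_trunc m.+1 (- (tau / 2 * a i ^+ 2)).
  under [RHS]eq_bigr do rewrite /exp_trunc mulr_sumr.
  rewrite exchange_big/= /S mulr_sumr; apply: eq_bigr => j _.
  have jm : (j <= m)%N by rewrite -ltnS.
  rewrite -sqr_gmom.
  have -> : - beta * (gmom tau j ^+ 2 / (j.*2)`!%:R) =
      - beta * gmom tau j * (gmom tau j / (j.*2)`!%:R) by rewrite expr2 !mulrA.
  rewrite -even_match// gmom_div_fact mulr_suml.
  apply: eq_bigr => i _; rewrite -[in RHS]mulNr [in RHS]exprMn -exprM mul2n.
  by ring.
rewrite -lerBlDl -sumrB.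
apply: le_trans (ler_norm _) _; apply: le_trans (ler_norm_sum _ _ _) _.
have E0 : 0 <= (tau / 2) ^+ m.+1 / m.+1`!%:R * expR (b ^+ 2).
  by rewrite mulr_ge0 ?expR_ge0// divr_ge0// exprn_ge0// divr_ge0.
rewrite -!mulrA; apply: le_trans (ler_wpM2r _ cA); last by rewrite mulrA.
rewrite mulr_suml; apply: ler_sum => i _.
rewrite -mulrBr normrM -[leRHS]mulrA ler_wpM2l//.
apply: le_trans (exp_taylor _ _) _.
rewrite normrN normrM (ger0_norm (divr_ge0 tau0 _))// normrX exprMn -exprM mul2n.
have e : expR (tau / 2 * `|a i| ^+ 2) <= expR (b ^+ 2).
  rewrite ler_expR; have : `|a i| ^+ 2 <= b ^+ 2.
    by apply: lerXn2r; rewrite ?nnegrE ?(b0 i) ?ab.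
  have := sqr_ge0 `|a i|; nra.
have F0 : 0 <= `|a i| ^+ (m.+1).*2 * ((tau / 2) ^+ m.+1 / m.+1`!%:R).
  by rewrite mulr_ge0 ?exprn_ge0// divr_ge0// exprn_ge0// divr_ge0.
apply: le_trans (le_trans _ (ler_wpM2l F0 e)) _.
  by rewrite le_eqVlt; apply/orP; left; apply/eqP; ring.
by rewrite le_eqVlt; apply/orP; left; apply/eqP; ring.
Qed.

(** The kernel (a i a j)^k separates, so the truncated double sum is a sum of squared moments over
    k!: odd ones vanish and even ones produce [S] again. *)
Lemma quad_term_le :
  \sum_i \sum_j c i * c j * expR (a i * a j) <=
  beta ^+ 2 * S + A ^+ 2 / (m.+1).*2`!%:R * expR (b ^+ 2).
Proof.
have -> : beta ^+ 2 * S =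
    \sum_i \sum_j c i * c j * exp_trunc (m.+1).*2 (a i * a j).
  transitivity (\sum_(k < (m.+1).*2) (\sum_i c i * a i ^+ k) ^+ 2 / k`!%:R).
    rewrite (big_even_odd m.+1 (fun k => (\sum_i c i * a i ^+ k) ^+ 2 / k`!%:R)).
    rewrite /S mulr_sumr; apply: eq_bigr => j _.
    have jm : (j <= m)%N by rewrite -ltnS.
    rewrite even_match// odd_match// expr0n/= mul0r addr0.
    by rewrite -sqr_gmom; ring.
  under eq_bigr do rewrite expr2 mulr_suml mulr_suml.
  rewrite exchange_big/=; apply: eq_bigr => i _.
  under eq_bigr do rewrite mulr_sumr mulr_suml.
  rewrite exchange_big/=; apply: eq_bigr => j _.
  rewrite /exp_trunc mulr_sumr; apply: eq_bigr => k _.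
  by rewrite exprMn; ring.
rewrite -lerBlDl -sumrB.
under eq_bigr do rewrite -sumrB.
apply: le_trans (ler_norm _) _; apply: le_trans (ler_norm_sum _ _ _) _.
set a2 := fun i => `|c i| * `|a i| ^+ (m.+1).*2.
have a20 i : 0 <= a2 i by rewrite mulr_ge0// exprn_ge0.
have E0 : 0 <= ((m.+1).*2`!%:R)^-1 * expR (b ^+ 2).
  by rewrite mulr_ge0 ?expR_ge0// invr_ge0.
apply: (@le_trans _ _ ((\sum_i a2 i) * (\sum_i a2 i) *
    (((m.+1).*2`!%:R)^-1 * expR (b ^+ 2)))); last first.
  rewrite -[leRHS]mulrA ler_wpM2r// -expr2 lerXn2r// nnegrE.
    exact: sumr_ge0.
  by apply: le_trans cA; exact: sumr_ge0.
rewrite !mulr_suml; apply: ler_sum => i _.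
apply: le_trans (ler_norm_sum _ _ _) _.
rewrite mulr_sumr mulr_suml; apply: ler_sum => j _.
rewrite -mulrBr !normrM.
apply: (@le_trans _ _ (`|c i| * `|c j| *
   (`|a i * a j| ^+ (m.+1).*2 / (m.+1).*2`!%:R * expR (b ^+ 2)))).
  rewrite ler_wpM2l ?mulr_ge0//; apply: le_trans (exp_taylor _ _) _.
  rewrite ler_wpM2l ?divr_ge0 ?exprn_ge0// ler_expR normrM expr2.
  by apply: ler_pM.
rewrite normrM exprMn /a2.
by rewrite le_eqVlt; apply/orP; left; apply/eqP; ring.
Qed.

(** The three main terms are [beta ^+ 2 * S] with factors 1, -2 and 1, so they cancel and only
    remainders survive. Truncating at a finite order avoids summing an infinite Hermite series. *)
Lemma chi2_moment_bound :
  beta ^+ 2 * (Num.sqrt (1 - tau ^+ 2))^-1 +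
  2 * beta * (\sum_i c i * expR (- (tau / 2 * a i ^+ 2))) +
  \sum_i \sum_j c i * c j * expR (a i * a j) <=
  2 * (tau ^+ 2) ^+ m.+1 +
  2 * (A * (tau / 2) ^+ m.+1 / m.+1`!%:R * expR (b ^+ 2)) +
  A ^+ 2 / (m.+1).*2`!%:R * expR (b ^+ 2).
Proof.
have /andP[tau0 tau12] := tau012; have /andP[be0 be1] := beta01.
have t2 : 0 <= tau ^+ 2 <= 1 / 2 by nra.
have h1 := inv_sqrt_onem_le m t2.
have h2 := cross_term_le; have h3 := quad_term_le.
have A0 : 0 <= A.
  by apply: le_trans cA; apply: sumr_ge0 => i _; rewrite mulr_ge0// exprn_ge0.
have E0 : 0 <= A * (tau / 2) ^+ m.+1 / m.+1`!%:R * expR (b ^+ 2).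
  by rewrite mulr_ge0 ?expR_ge0// divr_ge0// mulr_ge0// exprn_ge0// divr_ge0.
have y0 : 0 <= (tau ^+ 2) ^+ m.+1 by rewrite exprn_ge0// sqr_ge0.
move: h1 h2 h3 E0 y0; rewrite -/S.
move: (Num.sqrt _)^-1 (\sum_i c i * _) (\sum_i _) S => K X Y s.
move: (A * _ / _ * _) (A ^+ 2 / _ * _) ((tau ^+ 2) ^+ m.+1) => E F y h1 h2 h3 E0 y0.
have g1 := ler_wpM2l (sqr_ge0 beta) h1.
have g2 := ler_wpM2l be0 h2.
have : beta ^+ 2 * y <= y by rewrite ler_piMl// exprn_ile1.
have : beta * E <= E by rewrite ler_piMl.
rewrite expr2 in g1 g2 h3 *; nra.
Qed.

End moment_matching.

(** * Interpolation weights *)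

Section interpolation.
Context (R : realType).
Implicit Types (x s : R).

Lemma expD_ge_lin n s x : 0 <= s -> 0 <= x ->
  s ^+ n.+1 + n.+1%:R * x * s ^+ n <= (x + s) ^+ n.+1.
Proof.
move=> s0 x0; elim: n => [|n IHn]; first by rewrite !expr1 expr0; lra.
rewrite [leRHS]exprS; apply: le_trans (ler_wpM2l (addr_ge0 x0 s0) IHn).
rewrite [_ ^+ n.+2]exprS [s ^+ n.+1]exprS -[n.+2]addn1 natrD.
have : 0 <= x * x * (n.+1%:R * s ^+ n) by rewrite !mulr_ge0// exprn_ge0.
by move: (s ^+ n) (n.+1%:R) => y k; nra.
Qed.

(** Up to sign the coefficients are elementary symmetric polynomials, and the j-th one is at most
    the j-th power of the sum divided by j!. *)
Lemma coef_prod_onemX_le (I : Type) (r : seq I) (Q : pred I) (x : I -> R) j :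
  (forall i, 0 <= x i) ->
  `|(\prod_(i <- r | Q i) (1 - x i *: 'X))`_j| <=
  (\sum_(i <- r | Q i) x i) ^+ j / j`!%:R.
Proof.
move=> x0; elim: r j => [|i r IHr] j.
  by rewrite !big_nil coef1 expr0n; case: j => [|j]/=; rewrite ?normr1 ?normr0 ?fact0 ?divr1 ?mul0r.
rewrite !big_cons; case: ifP => // Qi.
set q := \prod_(_ <- r | _) _ in IHr *; set s := \sum_(_ <- r | _) _ in IHr *.
have s0 : 0 <= s by apply: sumr_ge0.
rewrite mulrBl mul1r -scalerAl coefB coefZ coefXM.
case: j => [|j]/=.
  by rewrite mulr0 subr0 expr0; have := IHr 0%N; rewrite expr0.
apply: le_trans (ler_normB _ _) _.
rewrite normrM (ger0_norm (x0 i)).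
apply: le_trans (lerD (IHr j.+1) (ler_wpM2l (x0 i) (IHr j))) _.
have f0 := fact_neq0 R j.
have -> : s ^+ j.+1 / j.+1`!%:R + x i * (s ^+ j / j`!%:R) =
   (s ^+ j.+1 + j.+1%:R * x i * s ^+ j) / j.+1`!%:R.
  by rewrite factS natrM; field; rewrite f0 nat1r pnatr_eq0.
by rewrite ler_wpM2r ?invr_ge0// expD_ge_lin.
Qed.

Lemma sum_inv_sqr_le m : \sum_(i < m) (i.+1%:R ^+ 2)^-1 <= 2 :> R.
Proof.
case: m => [|m]; first by rewrite big_ord0.
(* Strengthened by the telescoping correction so that the induction closes. *)
suff : \sum_(i < m.+1) (i.+1%:R ^+ 2)^-1 <= 2 - m.+1%:R^-1 :> R.
  by move=> /le_trans; apply; rewrite gerBl invr_ge0.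
elim: m => [|m IHm]; first by rewrite big_ord1 expr1n invr1; lra.
rewrite big_ord_recr/=; apply: le_trans (lerD IHm (lexx _)) _.
have m0 : 0 < m.+1%:R :> R by rewrite ltr0n.
rewrite -[m.+2]addn1 natrD; move: (m.+1%:R) m0 => x x0.
rewrite -subr_ge0.
have -> : 2 - (x + 1)^-1 - (2 - x^-1 + ((x + 1) ^+ 2)^-1) = (x * (x + 1) ^+ 2)^-1.
  by field; apply/andP; split; apply/eqP; lra.
by rewrite invr_ge0 mulr_ge0 ?sqr_ge0 ?ltW.
Qed.

Lemma prod_shift_fact a j : (\prod_(i < j) (a + i).+1 * a`! = (a + j)`!)%N.
Proof.
elim: j => [|j IHj]; first by rewrite big_ord0 mul1n addn0.
by rewrite big_ord_recr/= mulnAC IHj addnS factS mulnC.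
Qed.

Lemma prod_node_ratio_base k :
  (\prod_(i < k) (k.+1%:R ^+ 2 / i.+1%:R ^+ 2 - 1)) * (2 * (k.+1)`!%:R ^+ 2) =
  (k.+1.*2)`!%:R :> R.
Proof.
have -> : \prod_(i < k) (k.+1%:R ^+ 2 / i.+1%:R ^+ 2 - 1) =
   (\prod_(i < k) (k - i)%:R) * (\prod_(i < k) (k.+1 + i).+1%:R) /
   (\prod_(i < k) i.+1%:R) ^+ 2 :> R.
  rewrite -prodrXl -big_split -prodf_div/=; apply: eq_bigr => i _.
  have ik : (i <= k)%N by exact: ltnW.
  have i0 : i%:R + 1 != 0 :> R by rewrite natr1 pnatr_eq0.
  rewrite addSn natrB// -!natr1 natrD.
  by field.
have e1 : \prod_(i < k) i.+1%:R = k`!%:R :> R.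
  by have := prod_shift_fact 0 k; rewrite fact0 muln1 add0n => <-; rewrite natr_prod.
have e2 : \prod_(i < k) (k - i)%:R = k`!%:R :> R.
  rewrite -e1 (reindex_inj rev_ord_inj)/=; apply: eq_bigr => i _.
  by rewrite subKn// ltn_ord.
have e3 : \prod_(i < k) (k.+1 + i).+1%:R * (k.+1)`!%:R = (k.+1 + k)`!%:R :> R.
  by rewrite -prod_shift_fact natrM natr_prod.
have f0 := fact_neq0 R k; have f1 := fact_neq0 R k.+1.
have -> : (k.+1.*2)`!%:R = (k.+1.*2)%:R * (k.+1 + k)`!%:R :> R.
  by rewrite -natrM -addnn addnS factS.
rewrite e1 e2 -e3 -muln2 natrM factS natrM.
by field; rewrite f0.
Qed.

(** The Lagrange denominators at the squares factor as differences times sums of integers, hence are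
    ratios of factorials. The induction is on m - (k + 1), starting from [prod_node_ratio_base]. *)
Lemma prod_node_ratio m k : (k < m)%N ->
  (\prod_(i < m | i != k :> nat) `|1 - k.+1%:R ^+ 2 / i.+1%:R ^+ 2|) *
    (2 * m`!%:R ^+ 2) = (m - k.+1)`!%:R * (m + k.+1)`!%:R :> R.
Proof.
move=> km; rewrite -(subnKC km) addKn; move: (m - k.+1)%N => d {km m}.
elim: d => [|d IHd].
  rewrite addn0 fact0 mul1r addnn -prod_node_ratio_base; congr (_ * _).
  rewrite big_mkcond big_ord_recr/= eqxx/= mulr1; apply: eq_bigr => i _.
  rewrite neq_ltn ltn_ord/= distrC ger0_norm// subr_ge0 ler_pdivlMr ?exprn_gt0 ?ltr0n// mul1r.
  by rewrite lerXn2r ?nnegrE// ler_nat ltnS ltnW.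
rewrite (addnS k.+1 d); move: IHd; have [N NE] : exists N, N = (k.+1 + d)%N by exists (k.+1 + d)%N.
rewrite -NE => IHd; have kN : (k < N)%N by rewrite NE addSn ltnS leq_addr.
rewrite big_mkcond big_ord_recr/= -big_mkcond/= gtn_eqF//=.
rewrite ger0_norm; last first.
  rewrite subr_ge0 ler_pdivrMr ?exprn_gt0 ?ltr0n// mul1r.
  by rewrite lerXn2r ?nnegrE// ler_nat; lia.
rewrite (factS N) (factS d) (addSn N) (factS (N + k.+1)) !natrM.
have dE : d%:R = N%:R - k%:R - 1 :> R by rewrite NE natrD -natr1; ring.
move: IHd; move: (\prod_(_ < _ | _) _) => p.
move: (N`!%:R) (d`!%:R) ((N + k.+1)`!%:R) => f g h IHd.
have -> : (d.+1%:R * g * ((N + k.+1).+1%:R * h) : R) =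
  d.+1%:R * (N + k.+1).+1%:R * (g * h) by ring.
rewrite -IHd -!natr1 !natrD -!natr1 dE.
have N0 : N%:R + 1 != 0 :> R by rewrite natr1 pnatr_eq0.
by field.
Qed.

Lemma sqr_fact_le m k : (k <= m)%N -> (m`! ^ 2 <= (m - k)`! * (m + k)`!)%N.
Proof.
elim: k => [|k IHk] km; first by rewrite subn0 addn0 mulnn.
apply: leq_trans (IHk (ltnW km)) _.
rewrite addnS -(subnSK km) !factS -mulnA [leqRHS]mulnCA.
by rewrite leq_mul// ltnS; lia.
Qed.

(** Squared nodes give denominators bounded below uniformly in m; this is what keeps the
    interpolation weights from growing with m. *)
Lemma prod_node_ratio_ge m k : (k < m)%N ->
  1 / 2 <= \prod_(i < m | i != k :> nat) `|1 - k.+1%:R ^+ 2 / i.+1%:R ^+ 2| :> R.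
Proof.
move=> km; have := prod_node_ratio km.
have := sqr_fact_le km; rewrite -(ler_nat R) natrX natrM => h e; rewrite -e in h.
have f0 : 0 < m`!%:R ^+ 2 :> R by rewrite exprn_gt0// ltr0n fact_gt0.
by rewrite -(ler_pM2r f0); lra.
Qed.

Lemma size_prod_onemX_le (I : Type) (r : seq I) (Q : pred I) (x : I -> R) :
  (size (\prod_(i <- r | Q i) (1 - x i *: 'X))%R <= (count Q r).+1)%N.
Proof.
elim: r => [|i r IHr]; first by rewrite big_nil size_poly1.
rewrite big_cons /=; case: ifP => Qi; last by rewrite add0n.
apply: leq_trans (size_polyMleq _ _) _.
have s2 : (size (1 - x i *: 'X : {poly R})%R <= 2)%N.
  apply: leq_trans (size_polyD _ _) _; rewrite size_poly1 size_polyN geq_max/=.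
  by apply: leq_trans (size_scale_leq _ _) _; rewrite size_polyX.
by have := leq_add s2 IHr; case: (_ + _)%N => //=; lia.
Qed.

Lemma horner_onemX x y : (1 - x *: 'X).[y] = 1 - x * y :> R.
Proof. by rewrite !hornerE. Qed.

Section weights.
Context (m : nat).

Let z (k : 'I_m) : R := k.+1%:R ^+ 2.
Let q (k : 'I_m) : {poly R} := \prod_(i < m | i != k) (1 - (z i)^-1 *: 'X).
Let D (k : 'I_m) : R := (q k).[z k].

Let z_gt0 k : 0 < z k. Proof. by rewrite exprn_gt0// ltr0n. Qed.

Let z_inj : injective z.
Proof.
move=> i j /eqP; rewrite eqrXn2// eqr_nat eqSS => /eqP; exact: val_inj.
Qed.

Let norm_D_ge k : 1 / 2 <= `|D k|.
Proof.
rewrite /D /q horner_prod normr_prod.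
apply: (le_trans (prod_node_ratio_ge (ltn_ord k))).
rewrite le_eqVlt; apply/orP; left; apply/eqP; apply: eq_bigr => i _.
by rewrite horner_onemX [in RHS]mulrC.
Qed.

Let D_neq0 k : D k != 0.
Proof. by rewrite -normr_gt0; apply: lt_le_trans (norm_D_ge k); lra. Qed.

Let size_q k : (size (q k) <= m)%N.
Proof.
apply: leq_trans (size_prod_onemX_le _ _ _) _.
have -> : count (fun i => i != k) (index_enum 'I_m) = #|predC1 k|.
  by rewrite cardE /enum_mem size_filter; apply: eq_count.
by rewrite cardC1 card_ord prednK//; apply: leq_trans (ltn_ord k).
Qed.

(** Both sides have degree at most m and agree at the m + 1 points 0 and [z k]. For J > 0 the
    monomial vanishes at 0, so the node 0 contributes nothing. *)
Let interpolate J : (0 < J <= m)%N ->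
  'X^J = \sum_k (z k ^+ J / (z k * D k)) *: ('X * q k) :> {poly R}.
Proof.
move=> /andP[J0 Jm]; apply/eqP; rewrite -subr_eq0; apply/eqP.
apply: (@roots_geq_poly_eq0 _ _ (0 :: [seq z k | k <- enum 'I_m])).
- apply/andP; split.
    rewrite /root hornerD hornerN hornerXn expr0n eqn0Ngt J0 sub0r horner_sum.
    by rewrite big1 ?oppr0// => k _; rewrite hornerZ hornerM hornerX mul0r mulr0.
  apply/allP => _ /mapP[k _ ->]; rewrite /root hornerD hornerN hornerXn horner_sum.
  rewrite (bigD1 k)//= big1 ?addr0; last first.
    move=> i ik; rewrite hornerZ hornerM /q horner_prod (bigD1 k)/=; last by rewrite eq_sym.
    by rewrite horner_onemX mulVf ?gt_eqF// subrr mul0r !mulr0.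
  rewrite hornerZ hornerM hornerX -/(D k) divfK ?subrr//.
  by rewrite mulf_neq0// gt_eqF.
- rewrite /= map_inj_uniq// enum_uniq andbT; apply/mapP => -[k _] /eqP.
  by rewrite eq_sym gt_eqF.
- rewrite /= size_map size_enum_ord; apply: leq_trans (size_polyD _ _) _.
  rewrite geq_max size_polyXn ltnS Jm size_polyN/=.
  apply: leq_trans (size_sum _ _ _) _; apply/bigmax_leqP => k _.
  apply: leq_trans (size_scale_leq _ _) _.
  apply: leq_trans (size_polyMleq _ _) _.
  by rewrite size_polyX add2n/= ltnS.
Qed.

Context (M : nat -> R).

(* Lagrange interpolation at the nodes 0, 1^2, ..., m^2. *)
Definition node_weight (k : 'I_m) : R :=
  (z k * D k)^-1 * \sum_(j < m) M j.+1 * (q k)`_j.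

(** The weights are the values on the Lagrange basis of the linear functional sending X^j to [M j];
    applying it to [interpolate] gives the moments. *)
Lemma node_weight_moment J : (0 < J <= m)%N ->
  \sum_k node_weight k * k.+1%:R ^+ J.*2 = M J.
Proof.
move=> Jm.
transitivity (\sum_(j < m) M j.+1 * ('X^J : {poly R})`_j.+1); last first.
  case: J Jm => // J /= Jm; rewrite (bigD1 (Ordinal Jm))//= big1 ?addr0.
    by rewrite coefXn eqxx mulr1.
  by move=> i iJ; rewrite coefXn eqSS [_ == _]negbTE ?mulr0.
rewrite interpolate//.
under [RHS]eq_bigr do rewrite coef_sum mulr_sumr.
rewrite [RHS]exchange_big/=; apply: eq_bigr => k _.
rewrite /node_weight mulr_sumr mulr_suml; apply: eq_bigr => j _.
rewrite coefZ coefXM/= /z -exprM mul2n.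
by ring.
Qed.

(** The inverse nodes sum to at most 2, whence coefficients at most 2^j / j!; the denominator costs
    a factor 2, and the factor 1 / [z k] makes the weights summable over k. *)
Lemma node_weight_le (k : 'I_m) (B : R) :
  \sum_(j < m) `|M j.+1| * (2 ^+ j / j`!%:R) <= B ->
  `|node_weight k| <= 2 * B / k.+1%:R ^+ 2.
Proof.
move=> MB; rewrite /node_weight normrM normfV normrM (gtr0_norm (z_gt0 k)).
have B0 : 0 <= B.
  apply: le_trans MB; apply: sumr_ge0 => j _.
  by rewrite mulr_ge0// divr_ge0// exprn_ge0.
apply: (@le_trans _ _ ((z k * `|D k|)^-1 * B)).
  apply: ler_wpM2l; first by rewrite invr_ge0 mulr_ge0// ltW.
  apply: le_trans (ler_norm_sum _ _ _) _; apply: le_trans MB.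
  apply: ler_sum => j _; rewrite normrM ler_wpM2l//.
  apply: le_trans (coef_prod_onemX_le _ _ _ _) _.
    by move=> i; rewrite invr_ge0 ltW.
  rewrite ler_wpM2r ?invr_ge0//; apply: lerXn2r; rewrite ?nnegrE//.
    by apply: sumr_ge0 => i _; rewrite invr_ge0 ltW.
  apply: le_trans (sum_inv_sqr_le m); rewrite [leLHS]big_mkcond/=.
  by apply: ler_sum => i _; case: ifP => // _; rewrite invr_ge0 ltW// z_gt0.
have D2 : `|D k|^-1 <= 2.
  rewrite -[2]invrK lef_pV2 ?posrE ?invr_gt0 ?normr_gt0//.
  by apply: le_trans (norm_D_ge k); lra.
have zB : 0 <= (z k)^-1 * B by rewrite mulr_ge0// invr_ge0 ltW.
have := ler_wpM2l zB D2.
rewrite (invfM (z k) `|D k|) -/(z k); move: (z k)^-1 `|D k|^-1 => x y h.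
by rewrite mulrAC (le_trans h)// mulrC [x * B]mulrC mulrA.
Qed.

End weights.

(** Equivalently (2j+1)!! <= 3^j j!. The factor j! is exactly what the coefficient bound 2^j / j!
    absorbs later. *)
Lemma double_fact_le j : ((j.+1.*2)`! <= 3 ^ j * j`! * (2 ^ j.+1 * (j.+1)`!))%N.
Proof.
elim: j => [|j IHj]; first by [].
rewrite doubleS !factS.
have -> : (3 ^ j.+1 * (j.+1 * j`!) * (2 ^ j.+2 * (j.+2 * (j.+1 * j`!))) =
  (6 * (j.+1 * j.+2)) * (3 ^ j * j`! * (2 ^ j.+1 * (j.+1)`!)))%N.
  by rewrite factS !expnS; ring.
rewrite mulnA leq_mul//.
by rewrite -doubleS -mul2n; lia.
Qed.

Lemma norm_gmom_le (t : R) j : 0 <= t ->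
  `|gmom t j.+1| <= t ^+ j.+1 * (3 ^+ j * j`!%:R).
Proof.
move=> t0; rewrite /gmom -mulrA normrM normrX normrN (ger0_norm t0).
apply: ler_wpM2l; first exact: exprn_ge0.
rewrite ger0_norm ?divr_ge0 ?mulr_ge0 ?exprn_ge0//.
rewrite ler_pdivrMr ?mulr_gt0 ?exprn_gt0 ?ltr0n ?fact_gt0//.
by rewrite -!natrX -!natrM ler_nat double_fact_le.
Qed.

Lemma sum_half_le n : \sum_(j < n) (1 / 2 : R) ^+ j.+1 <= 1.
Proof.
suff -> : \sum_(j < n) (1 / 2 : R) ^+ j.+1 = 1 - (1 / 2) ^+ n.
  by rewrite gerBl exprn_ge0//; lra.
elim: n => [|n IHn]; first by rewrite big_ord0 expr0 subrr.
by rewrite big_ord_recr/= IHn exprS; lra.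
Qed.

Lemma weights_exist m (P w : R) : 0 <= P <= 1 / 6 -> 0 <= w <= 1 / 4 ->
  exists u : 'I_m -> R,
    (forall j, (0 < j <= m)%N ->
       \sum_k u k * k.+1%:R ^+ j.*2 = gmom (P * w) j + P * w ^+ j) /\
    \sum_k `|u k| <= 32 * (P * w ^+ 2).
Proof.
move=> /andP[P0 P6] /andP[w0 w4].
pose M j := gmom (P * w) j + P * w ^+ j.
exists (@node_weight m M); split=> [j jm|]; first exact: node_weight_moment.
have Pw2 : 0 <= P * w ^+ 2 by rewrite mulr_ge0 ?sqr_ge0.
have MB : \sum_(j < m) `|M j.+1| * (2 ^+ j / j`!%:R) <= 8 * (P * w ^+ 2).
  case: m => [|m']; first by rewrite big_ord0 mulr_ge0.
  rewrite big_ord_recl.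
  (* The second moments of the atoms and of the variance deficit cancel. Without this term every
     remaining one carries at least w^2, so the spikes have mass of order [P * w ^+ 2]. *)
  have -> : M 1%N = 0 by rewrite /M /gmom !expr1 (_ : (1.*2)`! = 2)%N// (_ : 1`! = 1)%N//; lra.
  rewrite normr0 mul0r add0r.
  apply: (@le_trans _ _ (8 * (P * w ^+ 2) * \sum_(j < m') (1 / 2) ^+ j.+1)); last first.
    by rewrite ler_piMr ?sum_half_le// mulr_ge0.
  rewrite mulr_sumr; apply: ler_sum => j _; rewrite lift0.
  have f0 : 0 < j.+1`!%:R :> R by rewrite ltr0n fact_gt0.
  have f1 : 1 <= j.+1`!%:R :> R by rewrite ler1n fact_gt0.
  have M1 : `|M j.+2| <= (P * w) ^+ j.+2 * (3 ^+ j.+1 * j.+1`!%:R) + P * w ^+ j.+2.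
    apply: le_trans (ler_normD _ _) _; apply: lerD.
      by apply: norm_gmom_le; rewrite mulr_ge0.
    by rewrite ger0_norm// mulr_ge0// exprn_ge0.
  apply: le_trans (ler_wpM2r _ M1) _; first by rewrite divr_ge0// exprn_ge0.
  have -> : ((P * w) ^+ j.+2 * (3 ^+ j.+1 * j.+1`!%:R) + P * w ^+ j.+2) *
      (2 ^+ j.+1 / j.+1`!%:R) =
      P * w ^+ j.+2 * ((6 * P) ^+ j.+1 + 2 ^+ j.+1 / j.+1`!%:R).
    rewrite !exprMn [P ^+ j.+2]exprS (_ : (6 : R) = 3 * 2); last by lra.
    by rewrite exprMn; field; rewrite gt_eqF.
  have P1 : (6 * P) ^+ j.+1 <= 2 ^+ j.+1.
    by apply: lerXn2r; rewrite ?nnegrE; lra.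
  have P2 : 2 ^+ j.+1 / j.+1`!%:R <= 2 ^+ j.+1 :> R.
    by rewrite ler_pdivrMr// ler_peMr// exprn_ge0.
  apply: (@le_trans _ _ (P * w ^+ j.+2 * (2 * 2 ^+ j.+1))).
    by apply: ler_wpM2l; [rewrite mulr_ge0// exprn_ge0|lra].
  have -> : P * w ^+ j.+2 * (2 * 2 ^+ j.+1) = 4 * (P * w ^+ 2) * (2 * w) ^+ j.
    by rewrite !exprS exprMn; ring.
  have -> : 8 * (P * w ^+ 2) * (1 / 2) ^+ j.+1 = 4 * (P * w ^+ 2) * (1 / 2) ^+ j.
    by rewrite [(1 / 2) ^+ _]exprS; field.
  apply: ler_wpM2l; first by rewrite mulr_ge0.
  by apply: lerXn2r; rewrite ?nnegrE; lra.
apply: (@le_trans _ _ (\sum_(k < m) 2 * (8 * (P * w ^+ 2)) / k.+1%:R ^+ 2)).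
  by apply: ler_sum => k _; exact: node_weight_le.
rewrite -mulr_sumr; apply: le_trans (ler_wpM2l _ (sum_inv_sqr_le m)) _; lra.
Qed.

End interpolation.

(** * The law of one coordinate *)

Section normal_products.
Context (R : realType) (s : R) (s0 : 0 < s).

Lemma normal_peak_div (x : R) : 0 < x -> normal_peak (s * x) = normal_peak s / x.
Proof.
move=> x0; rewrite /normal_peak exprMn -invfM; congr (_^-1).
have -> : s ^+ 2 * x ^+ 2 * pi *+ 2 = (s ^+ 2 * pi *+ 2) * x ^+ 2 by ring.
rewrite sqrtrM; last by apply: mulrn_wge0; apply: mulr_ge0; [exact: sqr_ge0|exact: pi_ge0].
by rewrite sqrtr_sqr gtr0_norm.
Qed.

(** This lemma and the next two factor [normal_pdf 0 s] out of a product of two mixture components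
    by completing the square. The cofactor is a constant times a normal density, so its integral is
    that constant. *)
Lemma normal_pdf_mul_shift (a b y : R) :
  normal_pdf (s * a) s y * normal_pdf (s * b) s y =
  normal_pdf 0 s y * (expR (a * b) * normal_pdf (s * (a + b)) s y).
Proof.
rewrite !normal_pdfE ?gt_eqF// /normal_fun.
rewrite mulrACA (mulrCA (expR (a * b))) [RHS]mulrACA -!expRD.
congr (_ * expR _); field; exact: lt0r_neq0.
Qed.

Lemma normal_pdf_mul_shrunk (tau a y : R) : 0 <= tau < 1 ->
  normal_pdf 0 (s * Num.sqrt (1 - tau)) y * normal_pdf (s * a) s y =
  normal_pdf 0 s y * (expR (- (tau / 2 * a ^+ 2)) *
    normal_pdf (s * (1 - tau) * a) (s * Num.sqrt (1 - tau)) y).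
Proof.
move=> /andP[t0 t1]; have t10 : 0 < 1 - tau by lra.
have r0 : 0 < Num.sqrt (1 - tau) by rewrite sqrtr_gt0.
have r2 : Num.sqrt (1 - tau) ^+ 2 = 1 - tau by rewrite sqr_sqrtr// ltW.
rewrite !normal_pdfE ?gt_eqF ?mulr_gt0// /normal_fun !exprMn r2.
rewrite (mulrCA (expR (- (tau / 2 * a ^+ 2)))) [LHS]mulrACA [RHS]mulrACA -!expRD.
congr (_ * expR _); first by rewrite mulrC.
by field; rewrite (gt_eqF s0) (gt_eqF t10).
Qed.

Lemma normal_pdf_sqr_shrunk (tau y : R) : 0 <= tau < 1 ->
  normal_pdf 0 (s * Num.sqrt (1 - tau)) y ^+ 2 =
  normal_pdf 0 s y * ((Num.sqrt (1 - tau ^+ 2))^-1 *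
    normal_pdf 0 (s * Num.sqrt ((1 - tau) / (1 + tau))) y).
Proof.
move=> /andP[t0 t1]; have t10 : 0 < 1 - tau by lra.
have t11 : 0 < 1 + tau by lra.
have r0 : 0 < Num.sqrt (1 - tau) by rewrite sqrtr_gt0.
have r2 : Num.sqrt (1 - tau) ^+ 2 = 1 - tau by rewrite sqr_sqrtr// ltW.
have q0 : 0 < Num.sqrt (1 + tau) by rewrite sqrtr_gt0.
have q2 : Num.sqrt (1 + tau) ^+ 2 = 1 + tau by rewrite sqr_sqrtr// ltW.
have -> : Num.sqrt ((1 - tau) / (1 + tau)) = Num.sqrt (1 - tau) / Num.sqrt (1 + tau).
  by rewrite sqrtrM ?(ltW t10)// sqrtrV ?(ltW t11).
have -> : Num.sqrt (1 - tau ^+ 2) = Num.sqrt (1 - tau) * Num.sqrt (1 + tau).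
  by rewrite -sqrtrM ?(ltW t10)//; congr Num.sqrt; ring.
have rq0 : 0 < Num.sqrt (1 - tau) / Num.sqrt (1 + tau) by rewrite divr_gt0.
move: (Num.sqrt (1 - tau)) (Num.sqrt (1 + tau)) r0 r2 q0 q2 rq0 => r q r0 r2 q0 q2 rq0.
rewrite !normal_pdfE ?gt_eqF ?mulr_gt0//; last by rewrite invr_gt0.
rewrite /normal_fun !normal_peak_div// expr2.
set p := normal_peak s.
rewrite mulrACA -expRD.
rewrite [RHS](_ : _ = p / r * (p / r) * (expR (- (y - 0) ^+ 2 / (s ^+ 2 *+ 2)) *
    expR (- (y - 0) ^+ 2 / ((s * (r / q)) ^+ 2 *+ 2)))); last first.
  by move: (expR _) (expR _) => e1 e2; field; rewrite (gt_eqF r0) (gt_eqF q0).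
rewrite -expRD; congr (_ * expR _).
rewrite !exprMn (exprVn q) r2 q2.
by field; rewrite (gt_eqF s0) (gt_eqF t10) (gt_eqF t11).
Qed.

End normal_products.

Section total_mass.
Local Open Scope ereal_scope.
Context (R : realType).
Local Notation mu := (@lebesgue_measure R).

(** Integrability is recorded with the value because the weights [c i] below are signed and
    linearity needs it. *)
Definition has_mass (h : R -> R) (x : R) :=
  mu.-integrable setT (EFin \o h) /\ \int[mu]_y (h y)%:E = x%:E.

Lemma has_mass_pdf m t : has_mass (normal_pdf m t) 1.
Proof. by split; [exact: integrable_normal_pdf|exact: integral_normal_pdf]. Qed.

Lemma has_massZ k h x : has_mass h x -> has_mass (fun y => k * h y)%R (k * x).
Proof.
move=> [ih eh]; split.
  by rewrite (_ : _ \o _ = (fun y => k%:E * (EFin \o h) y))//; exact: integrableZl.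
under eq_integral do rewrite EFinM.
by rewrite integralZl// eh.
Qed.

Lemma has_massD h1 x1 h2 x2 : has_mass h1 x1 -> has_mass h2 x2 ->
  has_mass (fun y => h1 y + h2 y)%R (x1 + x2).
Proof.
move=> [ih1 eh1] [ih2 eh2]; split.
  by rewrite (_ : _ \o _ = (EFin \o h1) \+ (EFin \o h2))//; exact: integrableD.
under eq_integral do rewrite EFinD.
by rewrite integralD// eh1 eh2.
Qed.

Lemma has_mass_sum (I : Type) (r : seq I) (h : I -> R -> R) (x : I -> R) :
  (forall i, has_mass (h i) (x i)) ->
  has_mass (fun y => \sum_(i <- r) h i y)%R (\sum_(i <- r) x i).
Proof.
move=> hm; elim: r => [|i r IHr].
  rewrite big_nil (_ : (fun _ => _) = cst 0%R); last first.
    by apply/funext => y; rewrite big_nil.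
  split; last by rewrite integral0.
  by rewrite (_ : _ \o _ = cst 0)//; exact: integrable0.
rewrite big_cons (_ : (fun _ => _) = (fun y => h i y + \sum_(j <- r) h j y)%R).
  exact: has_massD.
by apply/funext => y; rewrite big_cons.
Qed.

End total_mass.

Lemma big_option (T : Type) (idx : T) (op : Monoid.com_law idx) (I : finType)
    (F : option I -> T) :
  \big[op/idx]_o F o = op (F None) (\big[op/idx]_i F (Some i)).
Proof.
rewrite (bigD1 None)//=; congr (op _ _).
rewrite (reindex_omap Some id)/=; last by case.
by apply: eq_bigl => i; rewrite eqxx.
Qed.

Section translates.
Local Open Scope ereal_scope.
Context (R : realType).

Definition translate (c x : R) := (c + x)%R.

HB.instance Definition _ (c : R) :=
  isMeasurableFun.Build _ _ _ _ (translate c) (measurable_shift c).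

Lemma integral_translate (P : probability R R) (c : R) (g : R -> \bar R) :
  measurable_fun setT g -> (forall x, 0 <= g x) ->
  \int[distribution P (translate c)]_x g x = \int[P]_x g (c + x)%R.
Proof. by move=> mg g0; rewrite ge0_integral_distribution. Qed.

End translates.

Section one_coordinate.
Context (R : realType) (I : finType) (s tau beta : R) (a u v : I -> R) (i0 : I).
Local Notation mu := (@lebesgue_measure R).
Hypothesis s0 : 0 < s.
Hypothesis tau01 : 0 < tau < 1.
Hypothesis beta0 : 0 <= beta.
Hypothesis u0 : forall i, 0 <= u i.
Hypothesis v0 : forall i, 0 <= v i.
Hypothesis u1 : \sum_i u i = 1.
Hypothesis v1 : beta + \sum_i v i = 1.
Hypothesis ai0 : a i0 = 0.
Hypothesis ui0 : 1 / 2 <= u i0.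

Let t := s * Num.sqrt (1 - tau).
Let g i := normal_pdf (s * a i) s.
Let f0 y := \sum_i u i * g i y.
Let f1 y := beta * normal_pdf 0 t y + \sum_i v i * g i y.
Let c i := v i - u i.

(* Closed form of the integral of (f1 - f0)^2 / normal_pdf 0 s, where u and
   (beta, v) are the mixture weights of the two laws of a coordinate. *)
Definition chi_D := beta ^+ 2 * (Num.sqrt (1 - tau ^+ 2))^-1 +
  2 * beta * (\sum_i c i * expR (- (tau / 2 * a i ^+ 2))) +
  \sum_i \sum_j c i * c j * expR (a i * a j).

(** The quotient of (f1 - f0)^2 by [normal_pdf 0 s], as a signed combination of normal densities;
    replacing each density by its mass 1 gives [chi_D]. *)
Let G y := beta ^+ 2 * (Num.sqrt (1 - tau ^+ 2))^-1 *
    normal_pdf 0 (s * Num.sqrt ((1 - tau) / (1 + tau))) y +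
  2 * beta * (\sum_i c i * expR (- (tau / 2 * a i ^+ 2)) *
     normal_pdf (s * (1 - tau) * a i) t y) +
  \sum_i \sum_j c i * c j * expR (a i * a j) * normal_pdf (s * (a i + a j)) s y.

Let tau_ge0 : 0 <= tau < 1.
Proof. by have /andP[/ltW -> ->] := tau01. Qed.

Let sqr_diff y : (f1 y - f0 y) ^+ 2 = normal_pdf 0 s y * G y.
Proof.
have -> : f1 y - f0 y = beta * normal_pdf 0 t y + \sum_i c i * g i y.
  rewrite /f1 /f0 -addrA -sumrB; congr (_ + _).
  by apply: eq_bigr => i _; rewrite mulrBl.
rewrite sqrrD /G [RHS]mulrDr [X in _ = X + _]mulrDr; congr (_ + _ + _).
- by rewrite exprMn (normal_pdf_sqr_shrunk s0 _ tau_ge0); ring.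
- rewrite -mulr_natl mulr_sumr !mulr_sumr; apply: eq_bigr => i _.
  have := normal_pdf_mul_shrunk s0 (a i) y tau_ge0; rewrite -/t -/(g i y) => h.
  transitivity (2 * beta * c i * (normal_pdf 0 t y * g i y)); first by ring.
  by rewrite h; ring.
- rewrite expr2 mulr_suml mulr_sumr; apply: eq_bigr => i _.
  rewrite mulr_sumr mulr_sumr; apply: eq_bigr => j _.
  transitivity (c i * c j * (g i y * g j y)); first by ring.
  by rewrite /g normal_pdf_mul_shift//; ring.
Qed.

Let g_gt0 i y : 0 < g i y.
Proof.
by rewrite /g normal_pdfE ?gt_eqF// mulr_gt0 ?normal_peak_gt0 ?gt_eqF// expR_gt0.
Qed.

Let f0_ge y : 1 / 2 * normal_pdf 0 s y <= f0 y.
Proof.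
rewrite /f0 (bigD1 i0)//=; apply: ler_wpDr.
  by apply: sumr_ge0 => i _; rewrite mulr_ge0// ltW.
by rewrite /g ai0 mulr0; apply: ler_wpM2r => //; exact: normal_pdf_ge0.
Qed.

Let phi_gt0 y : 0 < normal_pdf 0 s y.
Proof. by have := g_gt0 i0 y; rewrite /g ai0 mulr0. Qed.

Let f0_gt0 y : 0 < f0 y.
Proof. by apply: lt_le_trans (f0_ge y); rewrite mulr_gt0//; lra. Qed.

Let f1_ge0 y : 0 <= f1 y.
Proof.
rewrite /f1 addr_ge0 ?mulr_ge0 ?normal_pdf_ge0//.
by apply: sumr_ge0 => i _; rewrite mulr_ge0// ltW.
Qed.

(** The atom 0 has null weight at least 1/2, so f0 is at least half of [normal_pdf 0 s]; this is the
    origin of the factor 2. The affine part 2 f1 - f0 integrates to 1. *)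
Let ratio_le y : f1 y ^+ 2 / f0 y <= 2 * G y + (2 * f1 y + - 1 * f0 y).
Proof.
have -> : f1 y ^+ 2 / f0 y = (f1 y - f0 y) ^+ 2 / f0 y + (2 * f1 y + - 1 * f0 y).
  by field; rewrite gt_eqF.
rewrite lerD2r ler_pdivrMr//.
have G0 : 0 <= G y by rewrite -(pmulr_rge0 _ (phi_gt0 y)) -sqr_diff sqr_ge0.
rewrite sqr_diff; have := ler_wpM2l G0 (f0_ge y); lra.
Qed.

Let mass_H : has_mass (fun y => 2 * G y + (2 * f1 y + - 1 * f0 y)) (1 + 2 * chi_D).
Proof.
have mf0 : has_mass f0 1.
  rewrite -u1 (eq_bigr (fun i => u i * 1)); last by move=> i _; rewrite mulr1.
  by apply: has_mass_sum => i; apply: has_massZ; exact: has_mass_pdf.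
have mf1 : has_mass f1 1.
  rewrite -v1 -[X in X + _]mulr1 (eq_bigr (fun i => v i * 1)); last by move=> i _; rewrite mulr1.
  apply: has_massD; first by apply: has_massZ; exact: has_mass_pdf.
  by apply: has_mass_sum => i; apply: has_massZ; exact: has_mass_pdf.
have mG : has_mass G chi_D.
  have -> : chi_D = beta ^+ 2 * (Num.sqrt (1 - tau ^+ 2))^-1 * 1 +
      2 * beta * (\sum_i c i * expR (- (tau / 2 * a i ^+ 2)) * 1) +
      \sum_i \sum_j c i * c j * expR (a i * a j) * 1.
    rewrite /chi_D mulr1; congr (_ + _ * _ + _).
      by apply: eq_bigr => i _; rewrite mulr1.
    by apply: eq_bigr => i _; apply: eq_bigr => j _; rewrite mulr1.
  apply: has_massD; first apply: has_massD.
  - by apply: has_massZ; exact: has_mass_pdf.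
  - apply: has_massZ; apply: has_mass_sum => i.
    by apply: has_massZ; exact: has_mass_pdf.
  - apply: has_mass_sum => i; apply: has_mass_sum => j.
    by apply: has_massZ; exact: has_mass_pdf.
have -> : 1 + 2 * chi_D = 2 * chi_D + (2 * 1 + - 1 * 1) by ring.
by apply: has_massD; [|apply: has_massD]; exact: has_massZ.
Qed.

Local Open Scope ereal_scope.

Let mg i : measurable_fun [set: R] (g i). Proof. exact: measurable_normal_pdf. Qed.

Let mf0 : measurable_fun [set: R] f0.
Proof. by apply: measurable_sum => i; apply: measurable_funM => //; exact: mg. Qed.

Let mf1 : measurable_fun [set: R] f1.
Proof.
apply: measurable_funD.
  by apply: measurable_funM => //; exact: measurable_normal_pdf.
by apply: measurable_sum => i; apply: measurable_funM => //; exact: mg.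
Qed.

Lemma one_coordinate_chi2 : exists (Pi0 Pi1 : probability R R) (l : R -> R),
  let P := conv_prob Pi0 (gauss s) in let Q := conv_prob Pi1 (gauss t) in
  [/\ forall h : R -> \bar R, measurable_fun setT h -> (forall x, 0 <= h x) ->
        \int[Pi0]_x h x = \sum_i (u i)%:E * h (s * a i)%R,
      forall h : R -> \bar R, measurable_fun setT h -> (forall x, 0 <= h x) ->
        \int[Pi1]_x h x = beta%:E * h 0%R +
          \sum_i (v i)%:E * \int[gauss (s * Num.sqrt tau)]_x h (s * a i + x)%R,
      measurable_fun setT l /\ (forall x, (0 <= l x)%R),
      forall h : R -> \bar R, measurable_fun setT h -> (forall x, 0 <= h x) ->
        \int[Q]_x h x = \int[P]_x (h x * (l x)%:E) &
      \int[P]_x ((l x) ^+ 2)%:E <= (1 + 2 * chi_D)%:E].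
Proof.
have [Pi0 Pi0E] := mixture_exists (fun i => \d_(s * a i)%R : probability R R) u0 u1.
pose w (o : option I) := if o is Some i then v i else beta.
pose m (o : option I) : probability R R := if o is Some i then
   distribution (gauss (s * Num.sqrt tau)) (translate (s * a i)) else \d_(0%R : R).
have w0 o : (0 <= w o)%R by case: o => [i|] /=.
have w1 : (\sum_o w o = 1)%R by rewrite big_option/=.
have [Pi1 Pi1E] := mixture_exists m w0 w1.
have st0 : (0 < s * Num.sqrt tau)%R.
  by rewrite mulr_gt0// sqrtr_gt0; case/andP: tau01.
have t0 : (0 < t)%R.
  by rewrite mulr_gt0// sqrtr_gt0 subr_gt0; case/andP: tau01.
(* Blur and reduced noise add up to the null noise level s, which makes the nonzero components of
   both laws translates of one density. *)
have tst : Num.sqrt (t ^+ 2 + (s * Num.sqrt tau) ^+ 2) = s.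
  have /andP[tau0 tau1] := tau01.
  rewrite !exprMn !sqr_sqrtr ?subr_ge0 ?ltW// -mulrDr subrK mulr1.
  by rewrite sqrtr_sqr gtr0_norm.
(* The likelihood ratio f1 / f0, written with [expR] and [ln] so that its measurability follows by
   composition. *)
pose l (y : R) : R := (f1 y * expR (- ln (f0 y)))%R.
have lE y : l y = (f1 y / f0 y)%R by rewrite /l expRN lnK ?posrE.
have m1 (f : R -> R) : measurable_fun [set: R] f ->
    measurable_fun [set: R] (fun x => (f x)%:E).
  by move=> mf; apply/measurable_EFinP.
have ml : measurable_fun [set: R] l.
  apply: measurable_funM => //; apply: measurableT_comp => //.
  apply: measurableT_comp => //; apply: measurableT_comp => //; exact: measurable_ln.
have l0 y : (0 <= l y)%R by rewrite /l mulr_ge0// expR_ge0.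
have Pi0E' h : measurable_fun [set: R] h -> (forall x, 0 <= h x) ->
    \int[Pi0]_x h x = \sum_i (u i)%:E * h (s * a i)%R.
  move=> mh h0; rewrite Pi0E//; apply: eq_bigr => i _.
  by rewrite integral_dirac// diracT mul1e.
have Pi1E' h : measurable_fun [set: R] h -> (forall x, 0 <= h x) ->
    \int[Pi1]_x h x = beta%:E * h 0%R +
      \sum_i (v i)%:E * \int[gauss (s * Num.sqrt tau)]_x h (s * a i + x)%R.
  move=> mh h0; rewrite (Pi1E h mh h0) big_option /=; congr (_ + _).
    by rewrite integral_dirac ?diracT ?mul1e.
  by apply: eq_bigr => i _; congr (_ * _); exact: integral_translate.
have mconv (h : R -> \bar R) r : measurable_fun [set: R] h -> (forall x, 0 <= h x) ->
    measurable_fun [set: R] (fun x => \int[gauss r]_y h (x + y)%R).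
  move=> mh h0; apply: (@measurable_fun_fubini_tonelli_F _ _ R R R (gauss r)
    (fun p : R * R => h (p.1 + p.2)%R)) => //.
  by apply: measurableT_comp => //; exact: measurable_addp.
have conv0 (h : R -> \bar R) r : (forall x, 0 <= h x) ->
    forall x, 0 <= \int[gauss r]_y h (x + y)%R.
  by move=> h0 x; apply: integral_ge0.
have PE h : measurable_fun [set: R] h -> (forall x, 0 <= h x) ->
    \int[conv_prob Pi0 (gauss s)]_x h x = \int[mu]_y (h y * (f0 y)%:E).
  move=> mh h0; rewrite integral_conv_prob// Pi0E'//; [|exact: mconv|exact: conv0].
  transitivity (\sum_i \int[mu]_y ((u i)%:E * (h y * (g i y)%:E))).
    apply: eq_bigr => i _; rewrite integral_gauss_translation ?gt_eqF//.
    rewrite ge0_integralZl//.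
    - by apply: emeasurable_funM => //; exact: m1.
    - by move=> y _; rewrite mule_ge0// lee_fin ltW.
    - by rewrite lee_fin.
  rewrite -ge0_integral_sum//; last 2 first.
  - move=> i; apply: emeasurable_funM => //.
    by apply: emeasurable_funM => //; exact: m1.
  - by move=> i y _; rewrite !mule_ge0// lee_fin// ltW.
  apply: eq_integral => y _; rewrite /f0 -sumEFin ge0_sume_distrr; last first.
    by move=> i _; rewrite lee_fin mulr_ge0// ltW.
  by apply: eq_bigr => i _; rewrite EFinM muleCA.
have QE h : measurable_fun [set: R] h -> (forall x, 0 <= h x) ->
    \int[conv_prob Pi1 (gauss t)]_x h x = \int[mu]_y (h y * (f1 y)%:E).
  move=> mh h0; rewrite integral_conv_prob// Pi1E'//; [|exact: mconv|exact: conv0].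
  have hg0 i y : 0 <= h y * (g i y)%:E by rewrite mule_ge0// lee_fin ltW.
  have mhg i : measurable_fun [set: R] (fun y => h y * (g i y)%:E).
    by apply: emeasurable_funM => //; exact: m1.
  have hb0 y : 0 <= h y * (normal_pdf 0 t y)%:E.
    by rewrite mule_ge0// lee_fin normal_pdf_ge0.
  have mhb : measurable_fun [set: R] (fun y => h y * (normal_pdf 0 t y)%:E).
    by apply: emeasurable_funM => //; apply: m1; exact: measurable_normal_pdf.
  transitivity (\int[mu]_y (beta%:E * (h y * (normal_pdf 0 t y)%:E)) +
      \sum_i \int[mu]_y ((v i)%:E * (h y * (g i y)%:E))).
    congr (_ + _).
      rewrite ge0_integralZl//; congr (_ * _).
      by apply: integral_gauss_translation => //; rewrite gt_eqF.
    apply: eq_bigr => i _; rewrite integral_gauss_gauss// tst -/(g i).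
    by rewrite ge0_integralZl; [by []|by []|exact: mhg|by move=> y _; exact: hg0|by rewrite lee_fin].
  have mvg i : measurable_fun [set: R] (fun y => (v i)%:E * (h y * (g i y)%:E)).
    exact: emeasurable_funM.
  have vg0 i y : 0 <= (v i)%:E * (h y * (g i y)%:E) by rewrite mule_ge0 ?lee_fin.
  rewrite -ge0_integral_sum// -ge0_integralD//; last 4 first.
  - by move=> y _; rewrite mule_ge0 ?lee_fin.
  - exact: emeasurable_funM.
  - by move=> y _; exact: sume_ge0.
  - exact: emeasurable_sum.
  apply: eq_integral => y _; rewrite /f1 EFinD ge0_muleDr; last 2 first.
  - by rewrite lee_fin mulr_ge0// normal_pdf_ge0.
  - by rewrite lee_fin; apply: sumr_ge0 => i _; rewrite mulr_ge0// ltW.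
  congr (_ + _); first by rewrite EFinM muleCA.
  rewrite -sumEFin ge0_sume_distrr; last first.
    by move=> i _; rewrite lee_fin mulr_ge0// ltW.
  by apply: eq_bigr => i _; rewrite EFinM muleCA.
exists Pi0, Pi1, l; split; [exact: Pi0E'|exact: Pi1E'|by split| |].
  move=> h mh h0; rewrite (QE h mh h0) PE; last 2 first.
  - by apply: emeasurable_funM => //; exact: m1.
  - by move=> x; rewrite mule_ge0// lee_fin.
  apply: eq_integral => y _; rewrite -muleA -EFinM lE divfK//.
  by rewrite gt_eqF.
rewrite PE; last 2 first.
- by apply: m1; exact: measurable_funX.
- by move=> x; rewrite lee_fin sqr_ge0.
case: mass_H => iH <-.
apply: ge0_le_integral => //.
- by move=> x _; rewrite mule_ge0 ?lee_fin ?sqr_ge0// ltW.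
- by apply: emeasurable_funM; apply: m1 => //; exact: measurable_funX.
- exact: (measurable_int mu).
move=> y _; rewrite -EFinM lee_fin; apply: le_trans (ratio_le y).
rewrite le_eqVlt; apply/orP; left; apply/eqP; rewrite lE.
by field; rewrite gt_eqF.
Qed.
End one_coordinate.

(** * The pair of priors *)

(** On the tail the density is at most half that of N(0, (2t)^2): their ratio is 2 e^(-z) with z = 3
    x^2 / (8 t^2) >= 3, and e^z >= 1 + z >= 4. *)
Lemma gauss_tail_le_half (R : realType) (t M : R) : 0 < t -> 48 * t ^+ 2 <= M ^+ 2 ->
  (gauss t [set x : R | ((M / 2) ^+ 2 <= x ^+ 2)%R]%classic <= (1 / 2)%:E)%E.
Proof.
move=> t0 Mt; set B := [set x | _].
have mB : measurable B.
  rewrite (_ : B = (fun x : R => x ^+ 2) @^-1` `[(M / 2) ^+ 2, +oo[).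
    by rewrite -[X in measurable X]setTI; apply: measurable_funX.
  by apply/seteqP; split => x /=; rewrite in_itv/= ?andbT.
have m1 : measurable_fun [set: R] (fun x : R => (\1_B x : R)%:E).
  by apply/measurable_EFinP; exact: measurable_indic.
have -> : gauss t B = (\int[gauss t]_x (\1_B x)%:E)%E.
  by rewrite integral_indic// setIT.
rewrite integral_gauss; [|exact: m1|by move=> x; rewrite lee_fin].
have [ih eh] := has_massZ (1 / 2) (@has_mass_pdf R 0 (2 * t)).
rewrite mulr1 in eh; rewrite -eh.
apply: ge0_le_integral => //.
- by move=> x _; rewrite mule_ge0 ?lee_fin ?normal_pdf_ge0.
- apply: emeasurable_funM; first exact: m1.
  by apply/measurable_EFinP; exact: measurable_normal_pdf.
- exact: (measurable_int (@lebesgue_measure R)).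
move=> x _; rewrite -!EFinM lee_fin indicE.
case: (boolP (x \in B)) => [|_]; last first.
  by rewrite mul0r mulr_ge0 ?normal_pdf_ge0//; lra.
rewrite inE [leLHS]mul1r => /= Bx.
rewrite !normal_pdfE ?gt_eqF ?mulr_gt0// (mulrC 2 t) normal_peak_div// /normal_fun subr0.
have p0 := @normal_peak_gt0 _ _ (lt0r_neq0 t0).
have t20 : 0 < t ^+ 2 by rewrite exprn_gt0.
set e1 := expR (- x ^+ 2 / (t ^+ 2 *+ 2)); set e2 := expR (- x ^+ 2 / _).
have e20 : 0 < e2 by exact: expR_gt0.
have -> : 1 / 2 * (normal_peak t / 2 * e2) = normal_peak t * (e2 / 4) by field.
apply: ler_wpM2l; first exact: ltW.
have -> : e1 = e2 * expR (- (3 * x ^+ 2 / (8 * t ^+ 2))).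
  by rewrite -expRD; congr expR; field; rewrite gt_eqF.
apply: ler_wpM2l; first exact: ltW.
have z3 : 3 <= 3 * x ^+ 2 / (8 * t ^+ 2).
  rewrite ler_pdivlMr ?mulr_gt0//.
  have {}Bx : (M / 2) ^+ 2 <= x ^+ 2 by exact: Bx.
  lra.
rewrite expRN lef_pV2 ?posrE ?expR_gt0//.
have := expR_ge1Dx (3 * x ^+ 2 / (8 * t ^+ 2)); lra.
Qed.

(** If |x| < |c| / 2 then |c + x| >= |c| / 2, so the blur keeps an atom large with probability at
    least 1/2. *)
Lemma gauss_large_ge_half (R : realType) (t c : R) : 0 < t -> 48 * t ^+ 2 <= c ^+ 2 ->
  ((1 / 2)%:E <=
   \int[gauss t]_x (\1_[set y : R | (c ^+ 2 / 4 <= y ^+ 2)%R] (c + x)%R)%:E)%E.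
Proof.
move=> t0 tc; set C := [set y | _].
set B := [set x : R | ((c / 2) ^+ 2 <= x ^+ 2)%R].
have msq K : measurable [set x : R | (K <= x ^+ 2)%R].
  rewrite (_ : [set _ | _] = (fun x : R => x ^+ 2) @^-1` `[K, +oo[).
    by rewrite -[X in measurable X]setTI; apply: measurable_funX.
  by apply/seteqP; split => x /=; rewrite in_itv/= ?andbT.
have mC : measurable C by exact: msq.
have mB : measurable B by exact: msq.
have mi (D : set R) : measurable D -> measurable_fun [set: R] (fun x : R => (\1_D x : R)%:E).
  by move=> mD; apply/measurable_EFinP; exact: measurable_indic.
have mCc : measurable_fun [set: R] (fun x : R => (\1_C (c + x)%R : R)%:E).
  by apply: (measurableT_comp (mi C mC)); exact: measurable_shift.
have B12 := gauss_tail_le_half t0 tc.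
have h : (1 <= \int[gauss t]_x (\1_C (c + x)%R)%:E + gauss t B)%E.
  have -> : gauss t B = (\int[gauss t]_x (\1_B x)%:E)%E.
    by rewrite integral_indic// setIT.
  rewrite -ge0_integralD; [|by []|by move=> x _; rewrite lee_fin|exact: mCc|
    by move=> x _; rewrite lee_fin|exact: mi].
  rewrite -(integral_prob1 (gauss t)); apply: ge0_le_integral => //.
    by apply: emeasurable_funD => //; exact: mi.
  move=> x _; rewrite -EFinD lee_fin !indicE.
  have [xB|xB] := boolP (x \in B); first by rewrite lerDr.
  suff -> : (c + x)%R \in C by rewrite addr0.
  rewrite inE /C /=; move: xB; rewrite notin_setE /B /= => /negP; rewrite -ltNge => xB.
  have := sqr_ge0 (c + 2 * x); have := sqr_ge0 (c - 2 * x); nra.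
move: h B12; move: (\int[_]_x _)%E (gauss t B) => [x| |] [y| |]//=; rewrite ?leey//.
by rewrite -EFinD !lee_fin; lra.
Qed.

Section prior.
Context (R : realType) (m : nat) (s P w : R).
Hypothesis s0 : 0 < s.
Hypothesis m0 : (0 < m)%N.
Hypothesis P0 : 0 < P <= 1 / 48.
Hypothesis w0 : 0 < w <= 1 / 4.

(* Atoms of the priors: None is 0, Some (b, Some k) is the lattice point
   +-(k+1)h, Some (b, None) is +-sqrt(w h2), with the sign given by b. *)
Let I : finType := option (bool * option 'I_m).
(** Since 81 = 3^4 exceeds e^4, each power of 1/81 yields a factor e^(-4), which pays for the
    factors e^m lost in the remainders and leaves e^(-2m). *)
Let h2 : R := (81 * m%:R)^-1.
Let h := Num.sqrt h2.
Let tau := P * w * h2.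
Let S := P * w ^+ 2.

Lemma big_atoms (F : I -> R) : \sum_i F i = F None +
  ((F (Some (true, None)) + \sum_k F (Some (true, Some k))) +
   (F (Some (false, None)) + \sum_k F (Some (false, Some k)))).
Proof.
rewrite big_option/=; congr (_ + _).
rewrite (eq_bigr (fun p : bool * option 'I_m => F (Some (p.1, p.2)))); last first.
  by case.
rewrite -(pair_bigA _ (fun b j => F (Some (b, j))))/= big_bool/=.
by rewrite !big_option.
Qed.

Context (z : 'I_m -> R).
Hypothesis zE : forall j, (0 < j <= m)%N ->
  \sum_k z k * k.+1%:R ^+ j.*2 = gmom (P * w) j + P * w ^+ j.
Hypothesis zS : \sum_k `|z k| <= 32 * S.

(** Signed weights cannot be probabilities: [zp] is placed in the null and [zn] in the alternative,
    and [beta] normalizes the alternative masses 1, P and those of [zn]. *)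
Let zp k := Num.max (z k) 0.
Let zn k := Num.max (- z k) 0.
Let beta := (1 + P + \sum_k zn k)^-1.
Let sg (b : bool) : R := if b then 1 else - 1.

Let a (i : I) : R := match i with
  | None => 0
  | Some (b, None) => sg b * (Num.sqrt w * h)
  | Some (b, Some k) => sg b * (h * k.+1%:R) end.
Let u (i : I) : R := match i with
  | None => 1 - beta * \sum_k zp k
  | Some (b, None) => 0
  | Some (b, Some k) => beta * zp k / 2 end.
Let v (i : I) : R := match i with
  | None => 0
  | Some (b, None) => beta * P / 2
  | Some (b, Some k) => beta * zn k / 2 end.
Let c i := v i - u i.

Let P_gt0 : 0 < P. Proof. by case/andP: P0. Qed.
Let w_gt0 : 0 < w. Proof. by case/andP: w0. Qed.
Let zp_ge0 k : 0 <= zp k. Proof. by rewrite /zp le_max lexx orbT. Qed.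
Let zn_ge0 k : 0 <= zn k. Proof. by rewrite /zn le_max lexx orbT. Qed.
Let zpn k : zp k - zn k = z k.
Proof. by rewrite /zp /zn; case: (leP (z k) 0) => ?; case: (leP (- z k) 0) => ?; lra. Qed.
Let zpD k : zp k + zn k = `|z k|.
Proof.
rewrite /zp /zn; case: (leP (z k) 0) => z1; case: (leP (- z k) 0) => z2.
- by rewrite (_ : z k = 0) ?normr0 ?addr0//; lra.
- by rewrite ler0_norm// add0r.
- by rewrite gtr0_norm// addr0.
- lra.
Qed.
Let S_ge0 : 0 <= S. Proof. by rewrite mulr_ge0 ?sqr_ge0// ltW. Qed.
Let S_le : S <= 1 / 768.
Proof.
have /andP[_ P1] := P0; have /andP[_ w1] := w0; rewrite /S.
have w2 : w ^+ 2 <= 1 / 16 by have := w_gt0; nra.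
by have := P_gt0; have := sqr_ge0 w; nra.
Qed.
Let zp_le : \sum_k zp k <= 32 * S.
Proof. by apply: le_trans zS; apply: ler_sum => k _; rewrite -zpD lerDl. Qed.
Let zn_le : \sum_k zn k <= 32 * S.
Proof. by apply: le_trans zS; apply: ler_sum => k _; rewrite -zpD lerDr. Qed.
Let szn_ge0 : 0 <= \sum_k zn k. Proof. exact: sumr_ge0. Qed.
Let szp_ge0 : 0 <= \sum_k zp k. Proof. exact: sumr_ge0. Qed.
Let beta_gt0 : 0 < beta.
Proof. by rewrite invr_gt0; have := P_gt0; have := szn_ge0; lra. Qed.
Let beta_le1 : beta <= 1.
Proof. by rewrite invf_le1; have := P_gt0; have := szn_ge0; lra. Qed.
Let beta_ge : 1 / 2 <= beta.
Proof.
rewrite /beta -[X in X <= _]invrK lef_pV2 ?posrE; have := P_gt0;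
have := szn_ge0; have := zn_le; have := S_le; have /andP[_ P1] := P0; lra.
Qed.
Let betaE : beta + beta * P + beta * \sum_k zn k = 1.
Proof.
rewrite -[X in X + _ + _]mulr1 -!mulrDr mulVf//.
by have := P_gt0; have := szn_ge0 => h1 h3; apply: lt0r_neq0; lra.
Qed.

Let m_gt0 : 0 < m%:R :> R. Proof. by rewrite ltr0n. Qed.
Let h2_gt0 : 0 < h2. Proof. by rewrite invr_gt0 mulr_gt0. Qed.
Let h_ge0 : 0 <= h. Proof. exact: sqrtr_ge0. Qed.
Let hh : h ^+ 2 = h2. Proof. by rewrite sqr_sqrtr// ltW. Qed.
Let h2_le : h2 <= 1 / 81.
Proof.
rewrite /h2 -div1r ler_pdivrMr ?mulr_gt0//.
have : 1 <= m%:R :> R by rewrite ler1n.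
lra.
Qed.
Let tau_gt0 : 0 < tau. Proof. by rewrite !mulr_gt0. Qed.

Let u_ge0 i : 0 <= u i.
Proof.
case: i => [[b [k|]]|]//=; first by rewrite divr_ge0// mulr_ge0// ltW.
have := S_le; have := zp_le; have := szp_ge0; have := beta_le1; have := beta_gt0.
by move: beta (\sum_k zp k) => x y; nra.
Qed.
Let v_ge0 i : 0 <= v i.
Proof.
by case: i => [[b [k|]]|]//=; rewrite divr_ge0// mulr_ge0// ltW.
Qed.
Let u_sum : \sum_i u i = 1.
Proof. by rewrite big_atoms/= -mulr_suml -mulr_sumr; lra. Qed.
Let v_sum : beta + \sum_i v i = 1.
Proof. by rewrite big_atoms/= -mulr_suml -mulr_sumr; have := betaE; lra. Qed.
Let u_None : 1 / 2 <= u None.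
Proof.
rewrite /=.
have := S_le; have := zp_le; have := szp_ge0; have := beta_le1; have := beta_gt0.
by move: beta (\sum_k zp k) => x y; nra.
Qed.

Let sgX b j : sg b ^+ j.*2 = 1.
Proof. by rewrite -mul2n exprM; case: b; rewrite ?sqrrN !expr1n. Qed.

Let a_even b o j : a (Some (b, o)) ^+ j.*2 =
  if o is Some k then h2 ^+ j * k.+1%:R ^+ j.*2 else (w * h2) ^+ j.
Proof.
case: o => [k|]; rewrite /a exprMn sgX mul1r exprMn -[j.*2]mul2n !exprM hh //.
by rewrite sqr_sqrtr ?ltW// exprMn.
Qed.

Let cE b o : c (Some (b, o)) =
  if o is Some k then - (beta * z k / 2) else beta * P / 2.
Proof.
case: o => [k|]; rewrite /c/=; last by rewrite subr0.
by rewrite -(zpn k); lra.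
Qed.

Let gmom_tau j : gmom tau j = h2 ^+ j * gmom (P * w) j.
Proof. by rewrite /gmom /tau -mulNr exprMn; ring. Qed.

(** In units of h, the atoms of mass [beta * P] give [beta * P * w ^+ j] and the spikes subtract
    [beta] times the interpolated moment, leaving the Gaussian term. Order 0 is the balance of total
    masses. *)
Let match_even j : (j <= m)%N -> \sum_i c i * a i ^+ j.*2 = - beta * gmom tau j.
Proof.
move=> jm; case: j jm => [|j] jm.
  have -> : \sum_i c i * a i ^+ 0.*2 = \sum_i v i - \sum_i u i.
    by rewrite -sumrB; apply: eq_bigr => i _; rewrite double0 expr0 mulr1.
  rewrite u_sum (_ : \sum_i v i = 1 - beta); last by have := v_sum; lra.
  by rewrite /gmom double0 !expr0 fact0; lra.
rewrite big_atoms (_ : a None ^+ (j.+1).*2 = 0); last by rewrite doubleS exprS mul0r.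
rewrite mulr0 add0r !a_even !cE.
have e : \sum_(k < m) - (beta * z k / 2) * (h2 ^+ j.+1 * k.+1%:R ^+ (j.+1).*2) =
    - (beta / 2 * h2 ^+ j.+1 * (gmom (P * w) j.+1 + P * w ^+ j.+1)).
  rewrite -zE// mulr_sumr -sumrN; apply: eq_bigr => k _; by ring.
have e' b : \sum_(k < m) c (Some (b, Some k)) * a (Some (b, Some k)) ^+ (j.+1).*2 =
    - (beta / 2 * h2 ^+ j.+1 * (gmom (P * w) j.+1 + P * w ^+ j.+1)).
  by rewrite -e; apply: eq_bigr => k _; rewrite cE a_even.
by rewrite !e' gmom_tau exprMn; field.
Qed.

Let match_odd j : (j <= m)%N -> \sum_i c i * a i ^+ j.*2.+1 = 0.
Proof.
move=> jm; rewrite big_atoms (_ : a None ^+ j.*2.+1 = 0); last by rewrite exprS mul0r.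
rewrite mulr0 add0r.
have aN o : a (Some (false, o)) = - a (Some (true, o)).
  by case: o => [k|] /=; rewrite mulN1r mul1r.
have oddN (x : R) : (- x) ^+ j.*2.+1 = - x ^+ j.*2.+1.
  by rewrite exprNn -signr_odd /= odd_double/= expr1 mulN1r.
have key o : c (Some (false, o)) * a (Some (false, o)) ^+ j.*2.+1 =
    - (c (Some (true, o)) * a (Some (true, o)) ^+ j.*2.+1).
  by rewrite !cE aN oddN mulrN.
by rewrite key (eq_bigr _ (fun k _ => key (Some k))) sumrN -opprD subrr.
Qed.

Let b := h * m%:R.

Let bb : b ^+ 2 = m%:R / 81.
Proof.
rewrite /b exprMn hh /h2; field.
exact: lt0r_neq0.
Qed.

Let a_norm b' o : `|a (Some (b', o))| = if o is Some k then h * k.+1%:R else Num.sqrt w * h.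
Proof.
by case: o => [k|] /=; rewrite normrM; case: b' => /=;
  rewrite ?normrN normr1 mul1r ger0_norm// mulr_ge0// sqrtr_ge0.
Qed.

Let a_le i : `|a i| <= b.
Proof.
case: i => [[b' o]|]; last by rewrite normr0 mulr_ge0// ltW.
rewrite a_norm /b; case: o => [k|].
  by apply: ler_wpM2l => //; rewrite ler_nat.
rewrite mulrC; apply: ler_wpM2l => //.
apply: (@le_trans _ _ 1); last by rewrite ler1n.
by rewrite -sqrtr1 ler_sqrt//; have /andP[] := w0; lra.
Qed.

(** The spikes account for 32 S, the atoms +-sqrt([w * h2]) for S, since w^(m+1) <= w^2. *)
Let A := 33 * S * (m%:R / 81) ^+ m.+1.

Let c_moment_le : \sum_i `|c i| * `|a i| ^+ (m.+1).*2 <= A.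
Proof.
have even_norm i : `|a i| ^+ (m.+1).*2 = a i ^+ (m.+1).*2.
  by rewrite -mul2n !exprM real_normK ?num_real.
rewrite big_atoms (_ : `|a None| ^+ (m.+1).*2 = 0); last first.
  by rewrite normr0 doubleS exprS mul0r.
rewrite mulr0 add0r.
have half b' : `|c (Some (b', None))| * `|a (Some (b', None))| ^+ (m.+1).*2 +
    \sum_(k < m) `|c (Some (b', Some k))| * `|a (Some (b', Some k))| ^+ (m.+1).*2
    <= 33 / 2 * S * (m%:R / 81) ^+ m.+1.
  have -> : 33 / 2 * S * (m%:R / 81) ^+ m.+1 = S / 2 * (m%:R / 81) ^+ m.+1 +
      (32 * S) * (1 / 2 * (m%:R / 81) ^+ m.+1) by field.
  have X0 : 0 <= (m%:R / 81 : R) ^+ m.+1 by rewrite exprn_ge0// divr_ge0.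
  apply: lerD.
    rewrite even_norm a_even cE ger0_norm; last by rewrite !mulr_ge0// ltW// mulr_gt0.
    have e1 : (w * h2) ^+ m.+1 <= w ^+ 2 * (m%:R / 81) ^+ m.+1.
      rewrite exprMn; apply: ler_pM; rewrite ?exprn_ge0 ?(ltW w_gt0) ?(ltW h2_gt0)//.
        apply: ler_wiXn2l; rewrite ?(ltW w_gt0) ?ltnS//.
        by have /andP[] := w0; lra.
      apply: lerXn2r; rewrite ?nnegrE ?divr_ge0 ?(ltW h2_gt0)//.
      apply: le_trans h2_le _; rewrite ler_pM2r ?invr_gt0//.
      by rewrite ler1n.
    have e2 : beta * P / 2 <= P / 2.
      by rewrite ler_pM2r// ler_piMl// ltW.
    apply: le_trans (ler_pM _ _ e2 e1) _.
    - by rewrite !mulr_ge0// ltW// mulr_gt0.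
    - by rewrite exprn_ge0// mulr_ge0// ltW.
    - by rewrite /S; lra.
  apply: (@le_trans _ _ (\sum_(k < m) `|z k| * (1 / 2 * (m%:R / 81) ^+ m.+1))).
    apply: ler_sum => k _.
    have e1 : `|a (Some (b', Some k))| ^+ (m.+1).*2 <= (m%:R / 81) ^+ m.+1.
      rewrite -bb -exprM mul2n; apply: lerXn2r; rewrite ?nnegrE ?a_le//.
      by rewrite mulr_ge0// ltW.
    have cn : `|c (Some (b', Some k))| <= `|z k| * (1 / 2).
      rewrite cE normrN normrM normrM (gtr0_norm beta_gt0).
      rewrite [`|2^-1|]gtr0_norm ?invr_gt0// div1r.
      by rewrite ler_pM2r ?invr_gt0// ler_piMl.
    rewrite [leRHS]mulrA; exact: (ler_pM (normr_ge0 _) (exprn_ge0 _ (normr_ge0 _)) cn e1).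
  by rewrite -mulr_suml ler_wpM2r// mulr_ge0//; lra.
apply: le_trans (lerD (half _) (half _)) _.
by rewrite /A; lra.
Qed.

Let tau_le : tau <= 1 / 2.
Proof.
have /andP[_ P1] := P0; have /andP[_ w1] := w0.
have hPw : P * w <= 1 by rewrite mulr_ile1 ?ltW//; lra.
rewrite /tau; apply: (@le_trans _ _ (1 * (1 / 81))); last by lra.
by apply: ler_pM => //; rewrite ltW// mulr_gt0.
Qed.

Let inv81_le k : (1 / 81 : R) ^+ k <= expR (- (4 * k%:R)).
Proof.
have e81 : expR 4 <= 81 :> R.
  rewrite (_ : 4 = 4%:R * 1); last by rewrite mulr1.
  rewrite expRM_natl; apply: le_trans (lerXn2r 4 _ _ (expR1_le3 R)) _;
    rewrite ?nnegrE ?expR_ge0//.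
  by rewrite !exprS expr0; lra.
rewrite -mulNr expRM_natr; apply: lerXn2r; rewrite ?nnegrE ?expR_ge0//.
by rewrite expRN div1r lef_pV2// posrE ?expR_gt0.
Qed.

Let x_fact_le k : (m%:R / 81) ^+ k / k`!%:R <= expR (- (4 * k%:R)) * expR m%:R :> R.
Proof.
have x0 : 0 <= m%:R / 81 :> R by rewrite divr_ge0.
have r0 : 0 < 1 / 81 :> R by lra.
apply: le_trans (pow_div_fact_le k x0 r0) _.
rewrite (_ : m%:R / 81 / (1 / 81) = m%:R); last by field.
by apply: ler_wpM2r => //; exact: expR_ge0.
Qed.

(** The three remainders [T1], [T2], [T3] contribute 2, 2 * 33 and 1089 times S^2 e^(-2m), less than
    1200 in total. *)
Lemma chi_D_prior_le : chi_D tau beta a u v <= 1200 * S ^+ 2 * expR (- (2 * m%:R)).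
Proof.
have beta01 : 0 <= beta <= 1 by rewrite ltW.
have tau012 : 0 <= tau <= 1 / 2 by rewrite ltW.
apply: le_trans (chi2_moment_bound beta01 tau012 a_le c_moment_le match_even match_odd) _.
rewrite bb.
set E := expR (- (2 * m%:R)).
have mR : 1 <= m%:R :> R by rewrite ler1n.
have eb : expR (m%:R / 81) <= expR m%:R :> R by rewrite ler_expR; lra.
have em0 := expR_gt0 (m%:R : R).
have tS : tau ^+ 2 <= S * (1 / 81).
  have -> : tau ^+ 2 = S * (P * h2 ^+ 2) by rewrite /tau /S; ring.
  apply: ler_wpM2l => //.
  have h1 := h2_le; have h3 := h2_gt0; have /andP[_ P1] := P0; have P2 := P_gt0.
  have p1 : P <= 1 by apply: (le_trans P1); lra.
  have q1 : h2 <= 1 by apply: (le_trans h1); lra.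
  rewrite expr2 mulrA; apply: le_trans (ler_piMl _ _) h1; first exact: ltW.
  by apply: mulr_ile1 => //; exact: ltW.
have SX : S * (1 / 81) <= 1 / 81 by have := S_le; lra.
have t20 : 0 <= tau ^+ 2 by exact: sqr_ge0.
(* Two factors [tau ^+ 2] supply S^2 and the other m - 1 only decay. *)
have T1 : (tau ^+ 2) ^+ m.+1 <= S ^+ 2 * E.
  have -> : m.+1 = (2 + m.-1)%N by rewrite add2n prednK.
  rewrite (exprD (tau ^+ 2) 2 m.-1).
  apply: (@le_trans _ _ ((S * (1 / 81)) ^+ 2 * (1 / 81) ^+ m.-1)).
    have X81 : 0 <= 1 / 81 :> R by lra.
    have e1 : (tau ^+ 2) ^+ 2 <= (S * (1 / 81)) ^+ 2.
      by apply: lerXn2r => //; rewrite nnegrE// mulr_ge0.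
    have e2 : (tau ^+ 2) ^+ m.-1 <= (1 / 81) ^+ m.-1.
      by apply: lerXn2r => //; exact: le_trans SX.
    by apply: ler_pM => //; exact: exprn_ge0.
  rewrite exprMn -mulrA -exprD ler_wpM2l ?sqr_ge0//.
  apply: le_trans (inv81_le _) _; rewrite ler_expR add2n prednK//.
  by rewrite -natr1; lra.
(* One factor S comes from A, the other from the powers of tau. *)
have T2 : A * (tau / 2) ^+ m.+1 / m.+1`!%:R * expR (m%:R / 81) <= 33 * S ^+ 2 * E.
  have tt : (tau / 2) ^+ m.+1 <= S.
    apply: (@le_trans _ _ (tau ^+ 2)); last by apply: le_trans tS _; have := S_ge0; lra.
    apply: (@le_trans _ _ (tau ^+ m.+1)).
      by apply: lerXn2r; rewrite ?nnegrE; have := tau_gt0; lra.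
    by apply: ler_wiXn2l; rewrite ?ltnS ?ltW//; have := tau_le; lra.
  have -> : A * (tau / 2) ^+ m.+1 / m.+1`!%:R * expR (m%:R / 81) =
     (33 * S) * (tau / 2) ^+ m.+1 * (((m%:R / 81) ^+ m.+1 / m.+1`!%:R) * expR (m%:R / 81)).
    by rewrite /A; ring.
  have -> : 33 * S ^+ 2 * E = (33 * S) * S * E by ring.
  have S33 : 0 <= 33 * S by rewrite mulr_ge0.
  have n1 : 0 <= 33 * S * (tau / 2) ^+ m.+1.
    by rewrite mulr_ge0// exprn_ge0// divr_ge0// ltW.
  have F0 : 0 <= (m%:R / 81) ^+ m.+1 / m.+1`!%:R :> R.
    by rewrite divr_ge0// exprn_ge0// divr_ge0.
  have n2 : 0 <= (m%:R / 81) ^+ m.+1 / m.+1`!%:R * expR (m%:R / 81) :> R.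
    by rewrite mulr_ge0// expR_ge0.
  apply: (ler_pM n1 n2); first exact: ler_wpM2l.
  apply: le_trans (ler_pM F0 (expR_ge0 _) (x_fact_le _) eb) _.
  by rewrite -!expRD ler_expR -natr1; lra.
have T3 : A ^+ 2 / (m.+1).*2`!%:R * expR (m%:R / 81) <= 1089 * S ^+ 2 * E.
  have -> : A ^+ 2 / (m.+1).*2`!%:R * expR (m%:R / 81) =
     (1089 * S ^+ 2) * (((m%:R / 81) ^+ (m.+1).*2 / (m.+1).*2`!%:R) * expR (m%:R / 81)).
    by rewrite /A -muln2 exprM; ring.
  have F0 : 0 <= (m%:R / 81) ^+ (m.+1).*2 / (m.+1).*2`!%:R :> R.
    by rewrite divr_ge0// exprn_ge0// divr_ge0.
  apply: (ler_wpM2l (mulr_ge0 (ler0n R 1089) (sqr_ge0 S))).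
  apply: le_trans (ler_pM F0 (expR_ge0 _) (x_fact_le _) eb) _.
  by rewrite -!expRD ler_expR -muln2 natrM -natr1; lra.
have SE0 : 0 <= S ^+ 2 * E by rewrite mulr_ge0 ?sqr_ge0// expR_ge0.
lra.
Qed.

Let measurable_neq0 : measurable [set x : R | x != 0].
Proof.
rewrite (_ : [set _ | _] = ~` [set 0]); first exact: measurableC.
by apply/seteqP; split => x /= /eqP.
Qed.

Let measurable_large K : measurable [set x : R | (K <= x ^+ 2)%R].
Proof.
rewrite (_ : [set _ | _] = (fun x : R => x ^+ 2) @^-1` `[K, +oo[).
  by rewrite -[X in measurable X]setTI; apply: measurable_funX.
by apply/seteqP; split => x /=; rewrite in_itv/= ?andbT.
Qed.

Lemma prior_pair_of_weights : exists (Pi0 Pi1 : probability R R) (l : R -> R),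
  let Pr := conv_prob Pi0 (gauss s) in
  let Qr := conv_prob Pi1 (gauss (s * Num.sqrt (1 - tau))) in
  [/\ [/\ measurable_fun setT l, (forall x, 0 <= l x) &
        forall g : R -> \bar R, measurable_fun setT g -> (forall x, 0 <= g x)%E ->
          (\int[Qr]_x g x = \int[Pr]_x (g x * (l x)%:E))%E],
      (\int[Pr]_x ((l x) ^+ 2)%:E <= (1 + 2400 * S ^+ 2 * expR (- (2 * m%:R)))%:E)%E,
      (Pi0 [set x | x != 0%R] <= (32 * S)%:E)%E,
      (Pi1 [set x | x != 0%R] <= (P + 32 * S)%:E)%E &
      ((P / 4)%:E <= Pi1 [set x | (s ^+ 2 * (w * h2) / 4 <= x ^+ 2)%R])%E].
Proof.
have tau01 : 0 < tau < 1 by rewrite tau_gt0/=; apply: le_lt_trans tau_le _; lra.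
have aN : a None = 0 by [].
have [Pi0 [Pi1 [l [Pi0E Pi1E ml Ql l2]]]] := one_coordinate_chi2 s0 tau01
  (ltW beta_gt0) u_ge0 v_ge0 u_sum v_sum aN u_None.
have PiE (Q : probability R R) (C : set R) : measurable C ->
    Q C = (\int[Q]_x (\1_C x)%:E)%E.
  by move=> mC; rewrite integral_indic// setIT.
have mi (C : set R) : measurable C -> measurable_fun [set: R] (fun x : R => (\1_C x : R)%:E).
  by move=> mC; apply/measurable_EFinP; exact: measurable_indic.
have i0 (C : set R) (x : R) : (0 <= (\1_C x : R)%:E)%E by rewrite lee_fin.
have i1 (C : set R) (x : R) : \1_C x <= 1 :> R by rewrite indicE; case: (x \in C).
exists Pi0, Pi1, l; split.
- by case: ml.
- apply: le_trans l2 _; rewrite lee_fin lerD2l.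
  by have := chi_D_prior_le; lra.
- rewrite PiE// Pi0E//; last exact: mi.
  under eq_bigr do rewrite -EFinM.
  rewrite sumEFin lee_fin (bigD1 None)//= mulr0 indicE memNset ?mulr0 ?add0r/=; last by rewrite eqxx.
  have h3 : \sum_(i | i != None) u i <= 32 * S.
    have := u_sum; rewrite (bigD1 None)//= => h3.
    have h4 : \sum_(i | i != None) u i = beta * \sum_k zp k by lra.
    rewrite h4; apply: le_trans zp_le; rewrite ler_piMl//.
  apply: le_trans h3; apply: ler_sum => i _; by rewrite ler_piMr.
- rewrite PiE// Pi1E//; last exact: mi.
  rewrite indicE memNset/= ?mule0 ?add0e; last by rewrite eqxx.
  apply: (@le_trans _ _ (\sum_i (v i)%:E)%E).
    apply: lee_sum => i _; rewrite -[leRHS]mule1 lee_wpmul2l ?lee_fin//.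
    rewrite -[leRHS](integral_prob1 (gauss (s * Num.sqrt tau))).
    apply: ge0_le_integral => //.
      by apply: (measurableT_comp (mi _ measurable_neq0)); exact: measurable_shift.
    by move=> x _; rewrite lee_fin.
  rewrite sumEFin lee_fin.
  have := v_sum; have := betaE; have := zn_le; have := beta_le1; have := beta_gt0.
  have := szn_ge0; have := P_gt0.
  move: beta (\sum_k zn k) (\sum_i v i) => x y z1 h3 h4 h5 h6 h7 h8 h9.
  have : x * P <= P by rewrite ler_piMl// ltW.
  have : x * y <= y by rewrite ler_piMl// ltW.
  lra.
- set C := [set x | _]; have mC : measurable C by exact: measurable_large.
  rewrite PiE// Pi1E//; last exact: mi.
  (* Only the two atoms +-sqrt([w * h2]) are counted, each surviving the blur with probability 1/2;
     their joint mass [beta * P] is at least P/2. *)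
  pose y (i : I) : R := if i is Some (_, None) then 1 / 2 else 0.
  have yi i : ((y i)%:E <= \int[gauss (s * Num.sqrt tau)]_x (\1_C (s * a i + x)%R)%:E)%E.
    case: i => [[b' [k|]]|]; rewrite /y; try by apply: integral_ge0 => x _; rewrite lee_fin.
    have ac : (s * a (Some (b', None))) ^+ 2 = s ^+ 2 * (w * h2).
      have := a_even b' None 1%N; rewrite expr1 => ae.
      by rewrite exprMn; congr (_ * _); exact: ae.
    have -> : C = [set z : R | ((s * a (Some (b', None))) ^+ 2 / 4 <= z ^+ 2)%R].
      by rewrite ac.
    apply: gauss_large_ge_half.
      by rewrite mulr_gt0// sqrtr_gt0.
    (* The blur is small against the atom because [48 * P <= 1]. *)
    rewrite ac exprMn (sqr_sqrtr (ltW tau_gt0)) mulrCA.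
    apply: ler_wpM2l; first exact: sqr_ge0.
    have wh0 : 0 <= w * h2 by rewrite mulr_ge0// ltW.
    have -> : 48 * tau = (48 * P) * (w * h2) by rewrite /tau; ring.
    by rewrite ler_piMl//; have /andP[] := P0; lra.
  apply: (@le_trans _ _ (\sum_i (v i * y i)%:E)%E); last first.
    rewrite -[leLHS]add0e; apply: leeD; first by rewrite mule_ge0 ?lee_fin// ltW.
    by apply: lee_sum => i _; rewrite EFinM lee_wpmul2l ?lee_fin.
  rewrite sumEFin lee_fin big_atoms/=.
  rewrite !big1; try by move=> k _; rewrite mulr0.
  have := beta_ge; have := P_gt0; rewrite mul0r; nra.
Qed.

End prior.

Lemma prior_pair (R : realType) (m : nat) (s P w : R) : 0 < s -> (0 < m)%N ->
  0 < P <= 1 / 48 -> 0 < w <= 1 / 4 ->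
  let h2 := (81 * m%:R)^-1 in let S := P * w ^+ 2 in
  exists (Pi0 Pi1 : probability R R) (l : R -> R),
  let Pr := conv_prob Pi0 (gauss s) in
  let Qr := conv_prob Pi1 (gauss (s * Num.sqrt (1 - P * w * h2))) in
  [/\ [/\ measurable_fun setT l, (forall x, 0 <= l x) &
        forall g : R -> \bar R, measurable_fun setT g -> (forall x, 0 <= g x)%E ->
          (\int[Qr]_x g x = \int[Pr]_x (g x * (l x)%:E))%E],
      (\int[Pr]_x ((l x) ^+ 2)%:E <= (1 + 2400 * S ^+ 2 * expR (- (2 * m%:R)))%:E)%E,
      (Pi0 [set x | x != 0%R] <= (32 * S)%:E)%E,
      (Pi1 [set x | x != 0%R] <= (P + 32 * S)%:E)%E &
      ((P / 4)%:E <= Pi1 [set x | (s ^+ 2 * (w * h2) / 4 <= x ^+ 2)%R])%E].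
Proof.
move=> s0 m0 P0 w0 h2 S.
have P6 : 0 <= P <= 1 / 6 by lra.
have w4 : 0 <= w <= 1 / 4 by lra.
have [z [zE zS]] := weights_exist m P6 w4.
exact: (prior_pair_of_weights s0 m0 P0 w0 zE zS).
Qed.

(** * The lower bound *)

Section separation.
Context (R : realType) (n : nat).
Implicit Types (theta : n.-tuple R).

Lemma l0norm_hits theta : l0norm theta = hits [set x : R | x != 0] theta.
Proof.
rewrite /l0norm /hits; apply: eq_card => i; rewrite !inE.
by apply/idP/idP => [h|/set_mem//]; apply/mem_set.
Qed.

(** A k-sparse vector can match at most k of the large entries; each of the at least N others adds
    at least K to the squared distance. *)
Lemma d2set_ge theta (k : nat) (K N : R) : 0 <= K -> 0 <= N ->
  N + k%:R <= (hits [set x : R | K <= x ^+ 2] theta)%:R ->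
  Num.sqrt (N * K) <= d2set theta (B0 k).
Proof.
move=> K0 N0 hN; apply: lb_le_inf.
  (* A lower bound passes to [inf] only for a nonempty set; the zero vector is a witness. *)
  exists (d2 theta [tuple of nseq n 0]); exists [tuple of nseq n 0] => //.
  rewrite /B0 /= /l0norm (_ : finset _ = finset.set0) ?cards0//.
  apply/setP => i; rewrite !inE; apply/negbTE; rewrite negbK.
  by rewrite (tnth_nth 0) /= nth_nseq if_same.
move=> _ [y yk <-]; rewrite /d2 ler_sqrt; last first.
  by apply: sumr_ge0 => i _; exact: sqr_ge0.
pose C := [set x : R | K <= x ^+ 2].
pose H := [set i : 'I_n | tnth theta i \in C]%SET.
pose Y := [set i : 'I_n | tnth y i != 0]%SET.
apply: (@le_trans _ _ (\sum_(i in H :\: Y) K)).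
  rewrite sumr_const -mulr_natl ler_wpM2r//.
  have : (#|H| <= #|H :\: Y| + #|Y|)%N.
    rewrite -(cardsID Y H) addnC leq_add2l subset_leq_card//; exact: subsetIr.
  rewrite -(ler_nat R) natrD => hH.
  have : (#|Y|%:R <= k%:R :> R) by rewrite ler_nat.
  by move: hN; rewrite /hits -/H; lra.
rewrite big_mkcond/=; apply: ler_sum => i _; rewrite !inE.
case: ifP => [/andP[]|_]; last exact: sqr_ge0.
by rewrite negbK => /eqP -> Ki; rewrite subr0; have /set_mem := Ki.
Qed.

End separation.

Section lower_bound.
Local Open Scope ereal_scope.
Context (R : realType) (n k0 Delta m : nat) (sm sp : R) (w lam : R).
Let P : R := (Delta%:R / (4 * n%:R))%R.
Let h2 : R := ((81 * m%:R)^-1)%R.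
Let S : R := (P * w ^+ 2)%R.
Let x : R := (2400 * S ^+ 2 * expR (- (2 * m%:R)))%R.
Let s1 := (sp * Num.sqrt (1 - P * w * h2))%R.

Hypothesis n0 : (0 < n)%N.
Hypothesis m0 : (0 < m)%N.
Hypothesis sp0 : (0 < sp)%R.
Hypothesis smp : (sm <= sp)%R.
Hypothesis s1m : (sm <= s1)%R.
Hypothesis P0 : (0 < P <= 1 / 48)%R.
Hypothesis w0 : (0 < w <= 1 / 4)%R.
Hypothesis S32 : (128 * (n%:R * S) <= k0%:R)%R.
Hypothesis kD : (128 * k0%:R <= Delta%:R :> R)%R.
Hypothesis lam0 : (0 < lam)%R.

(** The null prior uses noise [sp], the alternative one [s1]. Three Chernoff events cost e^(-k0/2)
    each: too many null spikes, too many nonzero alternative entries, too few large ones. *)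
Lemma Rvar_ge (T : test R n) (rho : R) :
  (rho <= Num.sqrt (Delta%:R / 128 * (sp ^+ 2 * (w * h2) / 4)))%R ->
  (1 - lam - (expR (n%:R * x) - 1) / lam - 3 * expR (- (k0%:R / 2)))%:E <=
  Rvar sm sp T k0 Delta rho.
Proof.
move=> rhole.
have [Pi0 [Pi1 [l [[ml l0 Ql] l2 q0 q1 q2]]]] := prior_pair sp0 m0 P0 w0.
have nR : (0 < n%:R :> R)%R by rewrite ltr0n.
have x0 : (0 <= x)%R.
  exact: (mulr_ge0 (mulr_ge0 (ler0n R 2400) (sqr_ge0 S)) (expR_ge0 _)).
pose A := [set y : n.-tuple R | T y = true].
have mT b : measurable [set y : n.-tuple R | T y = b].
  rewrite (_ : [set _ | _] = T @^-1` [set b])//.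
  by rewrite -[X in measurable X]setTI; exact: measurable_funP.
have AC : ~` A = [set y : n.-tuple R | T y = false].
  by apply/seteqP; split => y /=; rewrite /A/=; case: (T y).
have := iid_testing_chi2 ml l0 Ql (n := n) lam0 x0 (mT true) l2.
rewrite -/A AC -/s1 => testing.
pose C0 := [set y : R | y != 0%R].
pose K := (sp ^+ 2 * (w * h2) / 4)%R.
pose C1 := [set y : R | (K <= y ^+ 2)%R].
have mC0 : measurable C0.
  rewrite (_ : C0 = ~` [set 0%R]); first exact: measurableC.
  by apply/seteqP; split => y /= /eqP.
have mC1 : measurable C1.
  rewrite (_ : C1 = (fun x : R => x ^+ 2)%R @^-1` `[K, +oo[).
    by rewrite -[X in measurable X]setTI; apply: measurable_funX.
  by apply/seteqP; split => y /=; rewrite in_itv/= ?andbT.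
have fineE (Q : probability R R) C : measurable C -> Q C = (fine (Q C))%:E.
  by move=> mC; rewrite fineK//; exact: fin_num_measure.
pose E0 := [set y : n.-tuple R | ((hits C0 y)%:R <= k0%:R :> R)%R].
pose E1 := [set y : n.-tuple R | ((hits C0 y)%:R <= (k0 + Delta)%:R :> R)%R].
pose E2 := [set y : n.-tuple R | (Delta%:R / 64 <= (hits C1 y)%:R :> R)%R].
have mE0 : measurable E0 by exact: measurable_hits_le.
have mE1 : measurable E1 by exact: measurable_hits_le.
have mE2 : measurable E2 by exact: measurable_hits_ge.
have k00 : (0 <= k0%:R :> R)%R by exact: ler0n.
have kD0 : (k0%:R <= Delta%:R :> R)%R.
  by apply: le_trans kD; rewrite ler_peMl// ler1n.
(* The mean is at most 32 n S; times the Chernoff factor 4 it stays within [S32]. *)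
have t0 : iid_prob Pi0 n (~` E0) <= (expR (- (k0%:R / 2)))%:E.
  apply: (@hits_upper_tail _ _ _ Pi0 _ mC0 n _ _ (fineE Pi0 C0 mC0)).
  have : (fine (Pi0 C0) <= 32 * S)%R by move: q0; rewrite (fineE Pi0 C0 mC0) lee_fin.
  move=> /(ler_wpM2l (ltW nR)); rewrite [leRHS]mulrCA.
  by move: S32; move: (n%:R * S)%R (n%:R * fine _)%R => a b; lra.
(* Here 4 n P = Delta, the reason for the 4 in P. *)
have t1 : iid_prob Pi1 n (~` E1) <= (expR (- (k0%:R / 2)))%:E.
  apply: (le_trans (@hits_upper_tail _ _ _ Pi1 _ mC0 n _ _ (fineE Pi1 C0 mC0) _)).
    have : (fine (Pi1 C0) <= P + 32 * S)%R by move: q1; rewrite (fineE Pi1 C0 mC0) lee_fin.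
    have nP : (n%:R * P = Delta%:R / 4)%R by rewrite /P; field; rewrite gt_eqF.
    move=> /(ler_wpM2l (ltW nR)); rewrite mulrDr nP natrD [X in (_ + X)%R]mulrCA.
    by move: S32; move: (n%:R * S)%R (n%:R * fine _)%R => a b; lra.
  by rewrite lee_fin ler_expR natrD lerN2; lra.
(* The mean is at least n P / 4 = Delta / 16, four times the threshold Delta / 64. *)
have t2 : iid_prob Pi1 n (~` E2) <= (expR (- (k0%:R / 2)))%:E.
  apply: (le_trans (@hits_lower_tail _ _ _ Pi1 _ mC1 n _ _ (fineE Pi1 C1 mC1) _)).
    have : (P / 4 <= fine (Pi1 C1))%R by move: q2; rewrite (fineE Pi1 C1 mC1) lee_fin.
    have nP : (n%:R * P = Delta%:R / 4)%R by rewrite /P; field; rewrite gt_eqF.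
    move=> /(ler_wpM2l (ltW nR)); rewrite mulrA nP.
    by move: (n%:R * fine _)%R => a; lra.
  by rewrite lee_fin ler_expR lerN2; move: kD; lra.
have t12 : iid_prob Pi1 n (~` (E1 `&` E2)) <= (2 * expR (- (k0%:R / 2)))%:E.
  rewrite setCI; apply: (le_trans (measureU2 _ _ _)) => //; try exact: measurableC.
  by rewrite mulr_natl mulr2n EFinD; apply: leeD.
have tau_ge0 : (0 <= P * w * h2)%R.
  have /andP[P1 _] := P0; have /andP[w1 _] := w0.
  by rewrite !mulr_ge0 ?invr_ge0 ?mulr_ge0// ltW.
have K_ge0 : (0 <= K)%R.
  have /andP[w1 _] := w0.
  by rewrite divr_ge0// mulr_ge0 ?sqr_ge0// mulr_ge0 ?invr_ge0 ?mulr_ge0// ltW.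
have sub0 : E0 `<=` B0 k0.
  by move=> y /= yk; rewrite /B0 /= l0norm_hits -(ler_nat R).
have sub1 : E1 `&` E2 `<=` B0sep (k0 + Delta) k0 rho.
  move=> y [/= yk yD]; split; first by rewrite /B0 /= l0norm_hits -(ler_nat R).
  apply: (le_trans rhole); apply: d2set_ge => //.
  (* As 128 k0 <= Delta, removing k0 of Delta / 64 large entries leaves Delta / 128. *)
  by apply: le_trans yD; move: kD; lra.
have J0 : `[sm, sp]%classic sp by rewrite /= in_itv/= smp lexx.
have J1 : `[sm, sp]%classic s1.
  rewrite /= in_itv/= s1m /= /s1 ler_piMr ?(ltW sp0)//.
  by rewrite -[leRHS]sqrtr1 ler_sqrt// gerBl.
have h0 := bayes_risk_le Pi0 (mT true) mE0 sub0 J0.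
have h1 := bayes_risk_le Pi1 (mT false) (measurableI _ _ mE1 mE2) sub1 J1.
have {}h0 := le_trans h0 (leeD2l _ t0).
have {}h1 := le_trans h1 (leeD2l _ t12).
have {testing h0 h1} := le_trans testing (leeD h0 h1).
rewrite /Rvar.
(* Nonnegativity excludes the value -oo, and +oo makes the claim trivial. *)
have := @nnsup_ge0 R [set lawY p.1 p.2 [set y | T y = true] | p in B0 k0 `*` `[sm, sp]].
have := @nnsup_ge0 R [set lawY p.1 p.2 [set y | T y = false] |
           p in B0sep (k0 + Delta) k0 rho `*` `[sm, sp]].
move: (nnsup _) (nnsup _) => [a| |] [b| |]//=; rewrite ?leey//.
by rewrite -!EFinD !lee_fin; lra.
Qed.

End lower_bound.

Section constants.
Context (R : realType).

Lemma expR_sub1_le (y : R) : 0 <= y <= 1 / 2 -> expR y - 1 <= 2 * y.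
Proof.
move=> /andP[y0 y1].
have e0 := expR_gt0 y.
have : (1 - y) * expR y <= 1.
  have := ler_wpM2r (ltW e0) (expR_ge1Dx (- y)).
  by rewrite mulrC (mulrC (expR (- y))) -expRD subrr expR0 mulrC.
nra.
Qed.

Lemma expRN_le (y : R) : 0 < y -> expR (- y) <= y^-1.
Proof.
move=> y0; rewrite expRN lef_pV2 ?posrE ?expR_gt0//.
by have := expR_ge1Dx y; lra.
Qed.

Lemma ln1D_ge_half (y : R) : 1 <= y -> 1 / 2 <= ln (1 + y).
Proof.
move=> y1; rewrite -ler_expR lnK ?posrE; last by lra.
apply: (@le_trans _ _ 2); last by lra.
by have := @expR_sub1_le (1 / 2); lra.
Qed.

Lemma tail_le (eps k : R) : 0 < eps -> 0 < k -> 24 / eps <= k ->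
  3 * expR (- (k / 2)) <= eps / 4.
Proof.
move=> eps0 k0; rewrite ler_pdivrMr// => ke.
have : expR (- (k / 2)) <= (k / 2)^-1 by apply: expRN_le; rewrite divr_gt0.
have : (k / 2)^-1 <= eps / 12 by rewrite invf_div ler_pdivrMr//; lra.
lra.
Qed.

(** The constants are 128 from the count of separated entries, 32 = 8 * 4 from w and the halved
    atom, 81 from [h2], and c from replacing m by L. *)
Lemma rate_le (D k s m c L : R) : 0 < D -> 0 < m -> 0 < c -> 0 < L ->
  m <= c * L ->
  (128 * 32 * 81 * c)^-1 * s ^+ 2 * (Num.sqrt (D * k) / L) <=
  D / 128 * (s ^+ 2 * (Num.sqrt (k / D) / 8 * (81 * m)^-1) / 4).
Proof.
move=> D0 m0 c0 L0 mcL.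
have -> : Num.sqrt (D * k) = D * Num.sqrt (k / D).
  rewrite -[X in X * Num.sqrt _](ger0_norm (ltW D0)) -sqrtr_sqr -sqrtrM ?sqr_ge0//.
  by congr Num.sqrt; field; rewrite gt_eqF.
set z := Num.sqrt _.
have -> : (128 * 32 * 81 * c)^-1 * s ^+ 2 * (D * z / L) =
    s ^+ 2 * (D * z) * (128 * 32 * 81)^-1 * (c * L)^-1.
  by field; rewrite !gt_eqF.
have -> : D / 128 * (s ^+ 2 * (z / 8 * (81 * m)^-1) / 4) =
    s ^+ 2 * (D * z) * (128 * 32 * 81)^-1 * m^-1.
  by field; rewrite gt_eqF.
apply: ler_wpM2l; last by rewrite lef_pV2 ?posrE ?mulr_gt0.
have c0' : 0 <= (128 * 32 * 81)^-1 :> R by rewrite invr_ge0 !mulr_ge0.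
exact: (mulr_ge0 (mulr_ge0 (sqr_ge0 s) (mulr_ge0 (ltW D0) (sqrtr_ge0 _))) c0').
Qed.

End constants.

Theorem theorem4 (R : realType) (gamma kappa : R)
    (hgamma : 0 < gamma < 1) (hkappa : 0 < kappa < 1) :
  exists c1 c2 c3 : R, [/\ 0 < c1, 0 < c2, 0 < c3 &
    forall (sigma_m sigma_p : R), 0 < sigma_m -> sigma_m < sigma_p ->
      sigma_m / sigma_p <= kappa ->
    forall n k0 Delta : nat,
      Delta%:R <= n%:R / c1 -> c1 * k0%:R <= Delta%:R ->
      c1 * Num.sqrt n%:R <= c1 * k0%:R -> c2 <= n%:R ->
      ((c3 * sigma_p ^+ 2 *
          (Num.sqrt (Delta%:R * k0%:R) / ln (1 + k0%:R / Num.sqrt n%:R)))%:E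
        <= rho_star_var n sigma_m sigma_p gamma k0 Delta ^+ 2)%E].
Proof.
have /andP[g0 g1] := hgamma; have /andP[k0' k1] := hkappa.
pose eps := 1 - gamma.
have eps0 : 0 < eps by rewrite /eps; lra.
have eps1 : eps < 1 by rewrite /eps; lra.
(* Chosen so that e^(-2A) <= 1 / (2A) = eps^2 / 32. *)
pose A := 16 / eps ^+ 2.
have A0 : 0 < A by rewrite divr_gt0// exprn_gt0.
(* The second witness forces k0 >= sqrt n >= 24 / eps, as [tail_le] requires; the third is the
   constant of [rate_le] with c = 2A + 3. *)
exists (128 + (1 - kappa)^-1), ((24 / eps) ^+ 2), (128 * 32 * 81 * (2 * A + 3))^-1.
have ik : 0 < (1 - kappa)^-1 by rewrite invr_gt0; lra.
(* c1 >= (1 - kappa)^-1 makes the reduced noise level of the alternative at least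
   kappa * sigma_p, hence admissible. *)
split; [lra|by rewrite exprn_gt0// divr_gt0|by rewrite invr_gt0; apply: mulr_gt0; lra|].
move=> sm sp sm0 smp smk n k0 Delta Dn kD nk cn.
set c1 := 128 + (1 - kappa)^-1 in Dn kD nk *.
have c10 : 0 < c1 by rewrite /c1; lra.
have c128 : 128 <= c1 by rewrite /c1; lra.
have sp0 : 0 < sp by exact: lt_trans smp.
have nR : 0 < n%:R :> R by apply: lt_le_trans cn; rewrite exprn_gt0// divr_gt0.
have rn0 : 0 < Num.sqrt n%:R :> R by rewrite sqrtr_gt0.
have nk' : Num.sqrt n%:R <= k0%:R :> R by rewrite -(ler_pM2l c10).
have k00 : 0 < k0%:R :> R by exact: lt_le_trans nk'.
have kD128 : 128 * k0%:R <= Delta%:R :> R.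
  by apply: le_trans kD; rewrite ler_pM2r.
have D0 : 0 < Delta%:R :> R by apply: lt_le_trans kD128; rewrite mulr_gt0.
have k24 : 24 / eps <= k0%:R.
  apply: le_trans nk'; rewrite -[24 / eps]ger0_norm; last by rewrite divr_ge0// ltW.
  by rewrite -sqrtr_sqr ler_sqrt.
pose q := k0%:R / Num.sqrt n%:R : R.
have q1 : 1 <= q by rewrite /q ler_pdivlMr// mul1r.
have q0 : 0 < q by lra.
pose L := ln (1 + q).
have L12 : 1 / 2 <= L by exact: ln1D_ge_half.
have lq0 : 0 <= ln q by exact: ln_ge0.
have lqL : ln q <= L by rewrite ler_ln ?posrE; lra.
(* The part ln q lets e^(-2m) cancel the q^2 in n S^2, and A buys the accuracy. *)
pose m := (Num.truncn (ln q + A)).+1.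
have m0 : (0 < m)%N by [].
have mlo : ln q + A <= m%:R by rewrite ltW// /m truncnS_gt.
(* The additive constant A + 1 is at most 2 (A + 1) L because L >= 1/2. *)
have mhi : m%:R <= (2 * A + 3) * L.
  have : m%:R <= ln q + A + 1.
    rewrite /m -natr1 lerD2r truncn_le//; lra.
  nra.
(* The divisor 8 gives n P w^2 = k0 / 256, within the spike budget [S32]. *)
pose w := Num.sqrt (k0%:R / Delta%:R) / 8 : R.
pose P := Delta%:R / (4 * n%:R) : R.
pose h2 := (81 * m%:R)^-1 : R.

have mR0 : 0 < m%:R :> R by rewrite ltr0n.
have P0 : 0 < P by rewrite divr_gt0// mulr_gt0.
have Dn' : c1 * Delta%:R <= n%:R by move: Dn; rewrite ler_pdivlMr// mulrC.
have Pc : c1 * P <= 1 / 4.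
  by rewrite /P mulrA ler_pdivrMr ?mulr_gt0//; move: Dn' => /=; lra.
have Pk : P <= 1 - kappa.
  have : (1 - kappa)^-1 * P <= 1.
    by apply: le_trans (_ : c1 * P <= _); [rewrite ler_pM2r// /c1; lra|lra].
  by rewrite mulrC ler_pdivrMr ?mul1r//; lra.
have P48 : P <= 1 / 48.
  have : 128 * P <= c1 * P by rewrite ler_pM2r.
  by move: Pc; lra.
have r0 : 0 < k0%:R / Delta%:R :> R by rewrite divr_gt0.
have r1 : k0%:R / Delta%:R <= 1 :> R by rewrite ler_pdivrMr// mul1r; lra.
have w0 : 0 < w by rewrite /w divr_gt0// sqrtr_gt0.
have w1 : w <= 1 / 4.
  have : Num.sqrt (k0%:R / Delta%:R) <= 1 :> R by rewrite -[leRHS]sqrtr1 ler_sqrt.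
  by rewrite /w; lra.
have w2 : w ^+ 2 = k0%:R / Delta%:R / 64.
  by rewrite /w expr_div_n sqr_sqrtr ?(ltW r0)//; congr (_ / _); ring.
have nS : n%:R * (P * w ^+ 2) = k0%:R / 256.
  by rewrite w2 /P; field; rewrite !gt_eqF.
have h20 : 0 < h2 by rewrite invr_gt0 mulr_gt0.
have h21 : h2 <= 1.
  by rewrite invf_le1 ?mulr_gt0//; have : 1 <= m%:R :> R; [rewrite ler1n|lra].
pose s1 := sp * Num.sqrt (1 - P * w * h2).
have tauP : P * w * h2 <= P.
  rewrite -mulrA -[leRHS]mulr1 ler_pM2l//.
  by rewrite -[1]mulr1 ler_pM ?(ltW w0) ?(ltW h20)//; lra.
(* Since kappa^2 <= kappa <= 1 - P <= 1 - tau. *)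
have s1k : kappa * sp <= s1.
  rewrite /s1 mulrC ler_pM2l// -[leLHS]ger0_norm ?(ltW k0')// -sqrtr_sqr ler_sqrt; last by lra.
  by rewrite expr2; nra.
have sms1 : sm <= s1.
  by apply: le_trans s1k; move: smk; rewrite ler_pdivrMr.
have lam0 : 0 < eps / 4 by rewrite divr_gt0.
have S32 : 128 * (n%:R * (P * w ^+ 2)) <= k0%:R by rewrite nS; lra.
have n0 : (0 < n)%N by rewrite -(ltr_nat R).
pose x := 2400 * (P * w ^+ 2) ^+ 2 * expR (- (2 * m%:R)) : R.
have nx : n%:R * x <= eps ^+ 2 / 32.
  have nSS : n%:R * (P * w ^+ 2) ^+ 2 = q ^+ 2 / (256 * 256).
    have -> : (P * w ^+ 2) = k0%:R / 256 / n%:R by rewrite -nS; field; rewrite gt_eqF.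
    have -> : q ^+ 2 = k0%:R ^+ 2 / n%:R.
      by rewrite /q expr_div_n sqr_sqrtr ?(ltW nR).
    by field; rewrite gt_eqF.
  have e2m : expR (- (2 * m%:R)) <= (q ^+ 2)^-1 * (2 * A)^-1.
    apply: (@le_trans _ _ (expR (- (2 * ln q) + - (2 * A)))).
      by rewrite ler_expR; move: mlo; lra.
    rewrite expRD ler_pM ?expR_ge0//; last by apply: expRN_le; rewrite mulr_gt0.
    by rewrite expRN mulr_natl mulr2n expRD lnK ?posrE// expr2.
  have A2 : (2 * A)^-1 = eps ^+ 2 / 32 by rewrite /A; field; rewrite gt_eqF.
  have -> : n%:R * x = 2400 / (256 * 256) * (q ^+ 2 * expR (- (2 * m%:R))).
    rewrite /x; move: nSS; set B := (P * w ^+ 2) ^+ 2; set e := expR _ => nSS.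
    have -> : n%:R * (2400 * B * e) = 2400 * (n%:R * B) * e by ring.
    by rewrite nSS; field.
  have q20 : 0 < q ^+ 2 by rewrite exprn_gt0.
  have : q ^+ 2 * expR (- (2 * m%:R)) <= eps ^+ 2 / 32.
    apply: (le_trans (ler_wpM2l (ltW q20) e2m)).
    by rewrite mulrA divff ?gt_eqF// mul1r A2.
  have := mulr_ge0 (ltW q20) (expR_ge0 (- (2 * m%:R))).
  by move: (q ^+ 2 * _) => a a0 a1; lra.
have nx0 : 0 <= n%:R * x.
  apply: (mulr_ge0 (ltW nR)).
  exact: (mulr_ge0 (mulr_ge0 (ler0n R 2400) (sqr_ge0 _)) (expR_ge0 _)).
have e2 : eps ^+ 2 <= 1 by rewrite expr2; nra.
have Elam : (expR (n%:R * x) - 1) / (eps / 4) <= eps / 4.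
  rewrite ler_pdivrMr//.
  have : expR (n%:R * x) - 1 <= 2 * (n%:R * x).
    by apply: expR_sub1_le; rewrite nx0/=; move: nx e2; lra.
  by move: nx; rewrite expr2; lra.
have tails : 3 * expR (- (k0%:R / 2)) <= eps / 4 by exact: tail_le.
pose r2 := (128 * 32 * 81 * (2 * A + 3))^-1 * sp ^+ 2 *
          (Num.sqrt (Delta%:R * k0%:R) / L).
have A3 : 0 < 2 * A + 3 by lra.
have r20 : 0 <= r2.
  rewrite /r2; apply: mulr_ge0; last by rewrite divr_ge0 ?sqrtr_ge0//; lra.
  by rewrite mulr_ge0 ?sqr_ge0// invr_ge0 !mulr_ge0// ltW.
have r2le : r2 <= Delta%:R / 128 * (sp ^+ 2 * (w * h2) / 4).
  by apply: rate_le => //; move: L12; lra.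
have r2gt0 : 0 < r2.
  rewrite /r2; apply: mulr_gt0; last first.
    by rewrite divr_gt0 ?sqrtr_gt0 ?mulr_gt0//; lra.
  by rewrite mulr_gt0 ?exprn_gt0// invr_gt0 !mulr_gt0.
have P0' : 0 < P <= 1 / 48 by exact/andP.
have w0' : 0 < w <= 1 / 4 by exact/andP.
have rle : Num.sqrt r2 <= Num.sqrt (Delta%:R / 128 * (sp ^+ 2 * (w * h2) / 4)).
  exact: ler_wsqrtr.
(* Three errors of at most eps/4 leave a slack of eps/4, so the inequality is strict as the
   definition of [rho_var] demands. *)
have bound : gamma < 1 - eps / 4 - (expR (n%:R * x) - 1) / (eps / 4) -
    3 * expR (- (k0%:R / 2)).
  clear -Elam tails eps0.
  by move: ((_ - 1) / (eps / 4)) (3 * expR _) Elam tails => a b; rewrite /eps in eps0 *; lra.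
have risk T : (gamma%:E < @Rvar R n sm sp T k0 Delta (Num.sqrt r2))%E.
  have := @Rvar_ge R n k0 Delta m sm sp w (eps / 4) n0 m0 sp0 (ltW smp) sms1
    P0' w0' S32 kD128 lam0 T (Num.sqrt r2) rle.
  rewrite -/P -/x.
  move: bound; rewrite -lte_fin.
  move: (1 - _ - _ - _)%:E => b.
  exact: lt_le_trans.
have star : ((Num.sqrt r2)%:E <= @rho_star_var R n sm sp gamma k0 Delta)%E.
  apply: le_ereal_inf_tmp => _ [T _ <-]; apply: nnsup_ub.
  by exists (Num.sqrt r2) => //; split; rewrite ?sqrtr_gt0.
rewrite -/q -/L -/r2 -[X in X%:E]sqr_sqrtr// EFin_expe !expe2.
by apply: lee_pmul => //; rewrite lee_fin sqrtr_ge0.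
Qed.
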